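(* Let $\lambda:U\to R^*$ be a group homomorphism and let $c=\nu_\ell([G:P(\lambda)])$. Then $$N(\lambda)=KG\cdot(F_\lambda+L(c+1))$$ is an absolutely irreducible $KG$-submodule of $M(c)=L(c)/L(c+1)$.
   Context: Let $n\ge 2$ and $G=\mathrm{GL}_n(q)$, the general linear group over the finite field $F_q$ of characteristic $p$. Let $\ell\ne p$ be a prime, and let $R$ be a local principal ideal domain of characteristic $0$ with maximal ideal $\ell R$, containing a primitive $p$-th root of unity; $R^*$ is its unit group and $K=R/\ell R$. Modules are left modules. $\nu_\ell$ denotes the $\ell$-adic valuation of integers. $B$ is the group of upper triangular matrices in $G$ and $U$ the group of upper unitriangular matrices; $S_n$ is viewed as the subgroup of permutation matrices of $G$; $\widehat{S}=\sum_{s\in S}s\in RG$ for $S\subseteq G$. Put $\varepsilon=\sum_{\sigma\in S_n}\mathrm{sg}(\sigma)\,\sigma\widehat{B}\in RG$. The Steinberg lattice is the left ideal $I=RG\cdot\varepsilon$, and $L=I/\ell I$, a $KG$-module. Let $f:I\times I\to R$ be the restriction to $I$ of the $R$-bilinear form on $RG$ given by $(g,h)\mapsto\delta_{g,h}$ for $g,h\in G$, scaled by $1/|B|$ (it takes values in $R$). For $c\ge 0$ put $I(c)=\{x\in I : f(x,I)\subseteq \ell^cR\}$ and $L(c)=(I(c)+\ell I)/\ell I$. For a group homomorphism $\lambda:U\to R^*$, let $P(\lambda)$ be the subgroup of $G$ generated by $B$ and the transpositions $(i,i+1)$, $1\le i<n$, such that $\lambda$ is non-trivial on the root subgroup $X_{i,i+1}=\{I_n+aE^{i,i+1}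 : a\in F_q\}$. Put $E_\lambda=\sum_{u\in U}\lambda(u)u\varepsilon\in I$ and $F_\lambda=E_\lambda+\ell I\in L$. One has $F_\lambda\in L(c)$ and $F_\lambda\notin L(c+1)$ for $c=\nu_\ell([G:P(\lambda)])$. *)

(* Defs.v *)
From HB Require Import structures.
From mathcomp Require Import all_boot all_order all_algebra all_fingroup.
From mathcomp Require Import mxrepresentation.
From mathcomp Require Import ring_quotient generic_quotient fraction.
From mathcomp Require Import boolp.

Set Implicit Arguments.
Unset Strict Implicit.
Unset Printing Implicit Defensive.

Import GRing.Theory.
Local Open Scope ring_scope.
Local Open Scope quotient_scope.

(* Coefficient rings. [idealr_closed] is the library's notion of a proper
   ideal (a right ideal, but all rings here are commutative). *)

Definition principal_ideal_ring (R : comNzRingType) : Prop :=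
  forall S : {pred R}, idealr_closed S ->
    exists a : R, forall x, (x \in S) <-> (exists r, x = a * r).

Definition maximal_ideal (R : comNzRingType) (S : {pred R}) : Prop :=
  idealr_closed S /\
  forall T : {pred R}, idealr_closed T -> {subset S <= T} -> {subset T <= S}.

Definition local_with_maximal_ideal (R : comNzRingType) (a : R) : Prop :=
  forall S : {pred R},
    maximal_ideal S <-> (forall x, (x \in S) <-> (exists r, x = a * r)).

(* A model of the quotient field R / aR. *)
Record residue_field (R : comNzRingType) (a : R) := ResidueField {
  rf_sort :> fieldType;
  rf_proj : {rmorphism R -> rf_sort};
  rf_surj : forall k, exists r, rf_proj r = k;
  rf_ker : forall r, rf_proj r = 0 <-> exists s, r = a * s
}.

Section QuotientModule.
Variables (A : pzRingType) (V : lmodType A) (S : submodClosed V).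

(* The library does not infer [zmodClosed] from [submodClosed]. *)
Definition submod_pred : {pred V} := S.
HB.instance Definition _ := GRing.isZmodClosed.Build V submod_pred
  (GRing.submod_closedB (submodClosedP S)).

Definition quot_lmod := {ideal_quot submod_pred}.
HB.instance Definition _ := GRing.Zmodule.on quot_lmod.

Definition quot_lmod_pi (x : V) : quot_lmod := \pi_{ideal_quot submod_pred} x.

Lemma quot_lmod_piE x y : quot_lmod_pi x = quot_lmod_pi y <-> x - y \in S.
Proof. by rewrite -[x - y \in S]/(x - y \in submod_pred) Quotient.idealrBE; split=> /eqP. Qed.

Lemma quot_lmod_pi_surj (v : quot_lmod) : exists x, quot_lmod_pi x = v.
Proof. by exists (repr v); rewrite /quot_lmod_pi reprK. Qed.

Fact quot_lmod_pi_is_zmod_morphism : zmod_morphism quot_lmod_pi.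
Proof. exact: (raddfB (\pi_{ideal_quot submod_pred})). Qed.
HB.instance Definition _ := GRing.isZmodMorphism.Build V quot_lmod
  quot_lmod_pi quot_lmod_pi_is_zmod_morphism.

Definition quot_lmod_scale (a : A) (v : quot_lmod) : quot_lmod :=
  quot_lmod_pi (a *: repr v).

Lemma quot_lmod_scale_pi a x :
  quot_lmod_scale a (quot_lmod_pi x) = quot_lmod_pi (a *: x).
Proof.
apply/quot_lmod_piE; rewrite -scalerBr rpredZ //.
by apply/quot_lmod_piE; rewrite /quot_lmod_pi reprK.
Qed.

Fact quot_lmod_scalerA a b v :
  quot_lmod_scale a (quot_lmod_scale b v) = quot_lmod_scale (a * b) v.
Proof.
by have [x <-] := quot_lmod_pi_surj v; rewrite !quot_lmod_scale_pi scalerA.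
Qed.
Fact quot_lmod_scale1r : left_id 1 quot_lmod_scale.
Proof.
by move=> v; have [x <-] := quot_lmod_pi_surj v; rewrite quot_lmod_scale_pi scale1r.
Qed.
Fact quot_lmod_scalerDr : right_distributive quot_lmod_scale +%R.
Proof.
move=> a v w; have [x <-] := quot_lmod_pi_surj v.
have [y <-] := quot_lmod_pi_surj w.
by rewrite -raddfD !quot_lmod_scale_pi scalerDr raddfD.
Qed.
Fact quot_lmod_scalerDl v : {morph quot_lmod_scale^~ v : a b / a + b}.
Proof.
move=> a b; have [x <-] := quot_lmod_pi_surj v.
by rewrite !quot_lmod_scale_pi scalerDl raddfD.
Qed.
HB.instance Definition _ := GRing.Zmodule_isLmodule.Build A quot_lmod
  quot_lmod_scalerA quot_lmod_scale1r quot_lmod_scalerDr quot_lmod_scalerDl.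

End QuotientModule.

(* The group algebra A[gT], as functions under convolution. *)
Section GroupAlgebra.
Variables (A : comNzRingType) (gT : finGroupType).

Definition galg := {ffun gT -> A}.
HB.instance Definition _ := GRing.Lmodule.copy galg {ffun gT -> A^o}.

Definition galg_coef (a : galg) : gT -> A := fun_of_fin a.
Local Coercion galg_coef : galg >-> Funclass.

Definition gelt (g : gT) : galg := [ffun h => (h == g)%:R].

Definition galg_mul (a b : galg) : galg :=
  [ffun g => \sum_h a h * b (h^-1 * g)%g].

Lemma galgP (a b : galg) : (forall g, a g = b g) -> a = b.
Proof. by move=> h; apply/ffunP. Qed.

Lemma galg_mulE (a b : galg) g : galg_mul a b g = \sum_h a h * b (h^-1 * g)%g.
Proof. by rewrite /galg_coef ffunE. Qed.

Lemma geltE g h : gelt g h = (h == g)%:R.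
Proof. by rewrite /galg_coef ffunE. Qed.

Lemma galgD (a b : galg) g : galg_coef (a + b) g = a g + b g.
Proof. by rewrite /galg_coef ffunE. Qed.

Lemma galg0 g : galg_coef 0 g = 0.
Proof. by rewrite /galg_coef ffunE. Qed.

Lemma galg_mul_gelt g (a : galg) h : galg_mul (gelt g) a h = a (g^-1 * h)%g.
Proof.
rewrite galg_mulE (bigD1 g) //= geltE eqxx mul1r big1 ?addr0 // => k nk.
by rewrite geltE (negPf nk) mul0r.
Qed.

Lemma galg_mul_geltM g h : galg_mul (gelt g) (gelt h) = gelt (g * h)%g.
Proof.
apply: galgP => k; rewrite galg_mul_gelt !geltE.
by rewrite (can2_eq (mulKVg g) (mulKg g)).
Qed.

Fact galg_mulA : associative galg_mul.
Proof.
move=> a b c; apply: galgP => g; rewrite !galg_mulE.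
under eq_bigr do rewrite galg_mulE big_distrr /=.
under [RHS]eq_bigr do rewrite galg_mulE big_distrl /=.
rewrite [RHS]exchange_big /=; apply: eq_bigr => h _.
rewrite [RHS](reindex_inj (mulgI h)) /=; apply: eq_bigr => k _.
by rewrite mulrA mulKg invMg mulgA.
Qed.
Fact galg_mul1 : left_id (gelt 1%g) galg_mul.
Proof. by move=> a; apply: galgP => g; rewrite galg_mul_gelt invg1 mul1g. Qed.
Fact galg_mulr1 : right_id (gelt 1%g) galg_mul.
Proof.
move=> a; apply: galgP => g; rewrite galg_mulE (bigD1 g) //= geltE mulVg eqxx.
rewrite mulr1 big1 ?addr0 // => k nk.
by rewrite geltE -eq_mulVg1 (negPf nk) mulr0.
Qed.
Fact galg_mulDl : left_distributive galg_mul +%R.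
Proof.
move=> a b c; apply: galgP => g; rewrite galgD !galg_mulE -big_split.
by apply: eq_bigr => h _; rewrite galgD mulrDl.
Qed.
Fact galg_mulDr : right_distributive galg_mul +%R.
Proof.
move=> a b c; apply: galgP => g; rewrite galgD !galg_mulE -big_split.
by apply: eq_bigr => h _; rewrite galgD mulrDr.
Qed.
Fact galg_1neq0 : gelt 1%g != 0.
Proof.
apply/eqP => /(congr1 (fun a : galg => a 1%g)).
by rewrite geltE eqxx galg0 => /eqP; rewrite oner_eq0.
Qed.
HB.instance Definition _ := GRing.Zmodule_isNzRing.Build galg
  galg_mulA galg_mul1 galg_mulr1 galg_mulDl galg_mulDr galg_1neq0.

End GroupAlgebra.
Coercion galg_coef : galg >-> Funclass.
Arguments gelt {A gT} g.

(* V / lV as a KG-module, for an RG-module V and K = R / lR: an element of KG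
   acts through any lift of its coefficients to R. *)
Section Reduction.
Variables (R : comNzRingType) (l : nat).
Variables (gT : finGroupType) (V : lmodType (galg R gT)).

Definition multiples : {pred V} := fun x => `[< exists y, x = y *+ l >].

Fact multiples_submod_closed : submod_closed multiples.
Proof.
split=> [|a _ _ /asboolP[x ->] /asboolP[y ->]]; apply/asboolP.
  by exists 0; rewrite mul0rn.
by exists (a *: x + y); rewrite mulrnDl scalerMnr.
Qed.
HB.instance Definition _ := GRing.isSubmodClosed.Build (galg R gT) V multiples
  multiples_submod_closed.

Definition reduction (K : residue_field (l%:R : R)) := {ideal_quot multiples}.
HB.instance Definition _ K := GRing.Zmodule.copy (reduction K)
  {ideal_quot multiples}.

Variable K : residue_field (l%:R : R).

Definition red (x : V) : reduction K := \pi_{ideal_quot multiples} x.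

Lemma redE x y : red x = red y <-> exists z, x - y = z *+ l.
Proof.
have <- : x - y \in multiples <-> exists z, x - y = z *+ l.
  by split=> /asboolP.
by rewrite Quotient.idealrBE; split=> /eqP.
Qed.

Lemma red_surj (v : reduction K) : exists x, red x = v.
Proof. by exists (repr v); rewrite /red reprK. Qed.

Fact red_is_zmod_morphism : zmod_morphism red.
Proof. exact: (raddfB (\pi_{ideal_quot multiples})). Qed.
HB.instance Definition _ := GRing.isZmodMorphism.Build V (reduction K) red
  red_is_zmod_morphism.

Definition galg_proj (a : galg R gT) : galg K gT := [ffun g => rf_proj K (a g)].
Definition galg_lift (a : galg K gT) : galg R gT :=
  [ffun g => sval (cid (rf_surj (a g)))].

Lemma galg_projE a g : galg_proj a g = rf_proj K (a g).
Proof. by rewrite {1}/galg_coef ffunE. Qed.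

Lemma galg_liftK : cancel galg_lift galg_proj.
Proof.
move=> a; apply: galgP => g; rewrite galg_projE {1}/galg_coef ffunE.
exact: (svalP (cid (rf_surj (a g)))).
Qed.

Lemma galg_proj_eq a b : galg_proj a = galg_proj b -> exists c, a - b = c *+ l.
Proof.
move=> eq_ab; have h g : exists s, a g - b g = l%:R * s.
  by apply/(rf_ker K); rewrite rmorphB -!galg_projE eq_ab subrr.
exists ([ffun g => sval (cid (h g))] : galg R gT).
apply/ffunP => g; rewrite !ffunE ffunMnE ffunE.
by rewrite [LHS](svalP (cid (h g))) mulr_natl.
Qed.

Definition reduction_scale (a : galg K gT) (v : reduction K) : reduction K :=
  red (galg_lift a *: repr v).

Lemma reduction_scale_red a x :
  reduction_scale (galg_proj a) (red x) = red (a *: x).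
Proof.
have [c hc] := galg_proj_eq (galg_liftK (galg_proj a)).
have /redE [z hz] : red (repr (red x)) = red x by rewrite /red reprK.
apply/redE; exists (c *: repr (red x) + a *: z).
rewrite mulrnDl scalerMnl -hc scalerMnr -hz scalerBl scalerBr.
by rewrite addrA subrK.
Qed.

Lemma reduction_scale_lift a x :
  reduction_scale a (red x) = red (galg_lift a *: x).
Proof. by rewrite -{1}[a]galg_liftK reduction_scale_red. Qed.

Fact galg_projM a b : galg_proj (a * b) = galg_proj a * galg_proj b.
Proof.
apply: galgP => g; rewrite galg_projE !galg_mulE rmorph_sum.
by apply: eq_bigr => h _; rewrite rmorphM !galg_projE.
Qed.
Fact galg_projD a b : galg_proj (a + b) = galg_proj a + galg_proj b.
Proof. by apply: galgP => g; rewrite galgD !galg_projE galgD rmorphD. Qed.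
Fact galg_proj1 : galg_proj 1 = 1.
Proof. by apply: galgP => g; rewrite galg_projE !geltE rmorph_nat. Qed.

Fact reduction_scalerA a b v :
  reduction_scale a (reduction_scale b v) = reduction_scale (a * b) v.
Proof.
have [x <-] := red_surj v.
rewrite -{2}[a]galg_liftK -{2}[b]galg_liftK -galg_projM reduction_scale_red.
by rewrite !reduction_scale_lift scalerA.
Qed.
Fact reduction_scale1r : left_id 1 reduction_scale.
Proof.
move=> v; have [x <-] := red_surj v.
by rewrite -galg_proj1 reduction_scale_red scale1r.
Qed.
Fact reduction_scalerDr : right_distributive reduction_scale +%R.
Proof.
move=> a v w; have [x <-] := red_surj v; have [y <-] := red_surj w.
by rewrite -raddfD !reduction_scale_lift scalerDr raddfD.
Qed.
Fact reduction_scalerDl v : {morph reduction_scale^~ v : a b / a + b}.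
Proof.
move=> a b; have [x <-] := red_surj v.
rewrite -{1}[a]galg_liftK -{1}[b]galg_liftK -galg_projD reduction_scale_red.
by rewrite !reduction_scale_lift scalerDl raddfD.
Qed.
HB.instance Definition _ := GRing.Zmodule_isLmodule.Build (galg K gT) (reduction K)
  reduction_scalerA reduction_scale1r reduction_scalerDr reduction_scalerDl.

Lemma red_scale a x : galg_proj a *: red x = red (a *: x).
Proof. exact: reduction_scale_red. Qed.

End Reduction.
Arguments reduction {R l gT} V K.
Arguments red {R l gT V} K x.

Section AbsolutelyIrreducible.
Variables (K : fieldType) (gT : finGroupType) (W : lmodType (galg K gT)).

(* N is isomorphic to the left module of column vectors on which g acts as
   rho g; multiplicativity of rho is the same for left and right modules. *)
Definition affords d (rho : mx_representation K [set: gT] d) (N : {pred W}) :=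
  exists phi : 'cV[K]_d -> W,
    [/\ injective phi,
        {morph phi : u v / u + v},
        forall (a : galg K gT) v, phi ((\sum_g a g *: rho g) *m v) = a *: phi v
      & forall w, (w \in N) <-> (exists v, w = phi v)].

Definition absolutely_irreducible (N : {pred W}) : Prop :=
  exists (d : nat) (rho : mx_representation K [set: gT] d),
    affords rho N /\ mx_absolutely_irreducible rho.

(* The library defines absolute irreducibility by means of the enveloping
   algebra; it means irreducibility over every extension field. *)
Lemma mx_absolutely_irreducibleP d (rho : mx_representation K [set: gT] d) :
  mx_absolutely_irreducible rho <->
  (forall (E : fieldType) (f : {rmorphism K -> E}),
     mx_irreducible (map_repr f rho)).
Proof.
split=> [abs E f|irr].
  by apply: mx_abs_irrW; rewrite map_mx_abs_irr.
apply: (@group_closure_field_exists gT K) => -[E f closE].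
by rewrite -(map_mx_abs_irr f); apply/closE/irr.
Qed.

End AbsolutelyIrreducible.

Section Steinberg.
Variables (n : nat) (F : finFieldType).
(* {'GL_n[F]} consists of matrices of size n.-1.+1, which is n for n > 0. *)
Local Notation gT := {'GL_n[F]}.
Local Notation N := n.-1.+1.

Definition borel : {set gT} :=
  [set g | [forall i : 'I_N, forall j : 'I_N, (j < i)%N ==> (GLval g i j == 0)]].

Definition unitri : {set gT} :=
  [set g in borel | [forall i : 'I_N, GLval g i i == 1]].

Definition perm_GL (s : 'S_N) : gT := FinRing.Unit (unitmx_perm F s).

Definition root_elt (i j : 'I_N) (a : F) : 'M[F]_N := 1%:M + a *: delta_mx i j.

Section Coefficients.
Variables (R : idomainType).

Definition unitri_character (lam : gT -> R) : Prop :=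
  {in unitri, forall u, lam u \is a GRing.unit} /\
  {in unitri &, {morph lam : u v / (u * v)%g >-> u * v}}.

Definition nontrivial_on_root (lam : gT -> R) (i j : 'I_N) : bool :=
  [exists u : gT, [exists a : F, GLval u == root_elt i j a] && (lam u != 1)].

Definition parabolic (lam : gT -> R) : {set gT} :=
  <<borel :|: [set g : gT | [exists i : 'I_N, exists j : 'I_N,
       [&& (j == i.+1 :> nat), nontrivial_on_root lam i j
         & g == perm_GL (tperm i j)]]]>>%g.

Definition hat (S : {set gT}) : galg R gT := \sum_(s in S) gelt s.

Definition eps : galg R gT :=
  \sum_(s : 'S_N) (-1) ^+ s *: (gelt (perm_GL s) * hat borel).

Definition steinberg_ideal : {pred (galg R gT)^o} :=
  fun x => `[< exists a : galg R gT, x = a * eps >].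

Fact steinberg_ideal_submod_closed : submod_closed steinberg_ideal.
Proof.
split=> [|a _ _ /asboolP[x ->] /asboolP[y ->]]; apply/asboolP.
  by exists 0; rewrite mul0r.
by exists (a * x + y); rewrite mulrDl -mulrA.
Qed.
HB.instance Definition _ := GRing.isSubmodClosed.Build (galg R gT)
  (galg R gT)^o steinberg_ideal steinberg_ideal_submod_closed.

Record steinberg := Steinberg {
  steinberg_val :> (galg R gT)^o;
  steinberg_valP : steinberg_val \in steinberg_ideal }.
HB.instance Definition _ := [isSub for steinberg_val].
HB.instance Definition _ := [Choice of steinberg by <:].
HB.instance Definition _ := [SubChoice_isSubLmodule of steinberg by <:].

Fact eps_in_steinberg : (eps : (galg R gT)^o) \in steinberg_ideal.
Proof. by apply/asboolP; exists 1; rewrite mul1r. Qed.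
Definition steinberg_eps : steinberg := Steinberg eps_in_steinberg.

(* The form takes its values in R on I; dividing by |B| is done in Frac R. *)
Definition form (x y : galg R gT) : {fraction R} :=
  tofrac (\sum_g x g * y g) / #|borel|%:R.

Section Filtration.
Variable l : nat.

Definition Isub (c : nat) : {pred steinberg} := fun x =>
  `[< forall y : steinberg, exists r : R,
        form (steinberg_val x) (steinberg_val y) = tofrac (l%:R ^+ c * r) >].

Lemma form_mull (a x y : galg R gT) :
  form (a * x) y = \sum_h tofrac (a h) * form x (gelt h^-1%g * y).
Proof.
under [RHS]eq_bigr do rewrite mulrA -rmorphM.
rewrite -mulr_suml -rmorph_sum; congr (tofrac _ / _).
under [RHS]eq_bigr do rewrite mulr_sumr.
under [LHS]eq_bigr do rewrite galg_mulE mulr_suml.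
rewrite exchange_big /=; apply: eq_bigr => h _.
rewrite (reindex_inj (mulgI h)) /=; apply: eq_bigr => g _.
by rewrite galg_mul_gelt invgK mulKg mulrA.
Qed.

Lemma formDl (x y z : galg R gT) : form (x + y) z = form x z + form y z.
Proof.
rewrite /form -mulrDl -rmorphD -big_split; congr (tofrac _ / _).
by apply: eq_bigr => g _; rewrite galgD mulrDl.
Qed.

Fact Isub_submod_closed c : submod_closed (Isub c).
Proof.
split=> [|a x y /asboolP hx /asboolP hy]; apply/asboolP => z.
  exists 0; rewrite mulr0 /form big1 ?rmorph0 ?mul0r // => g _.
  by rewrite galg0 mul0r.
have zP h : ((gelt h * steinberg_val z : galg R gT) : (galg R gT)^o)
    \in steinberg_ideal.
  exact: (rpredZ (gelt h : galg R gT) (steinberg_valP z)).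
have hx' h := cid (hx (Steinberg (zP h^-1%g))).
have [r hr] := hy z.
exists (\sum_h a h * sval (hx' h) + r).
rewrite [steinberg_val _]/(a * steinberg_val x + steinberg_val y) formDl.
rewrite form_mull hr mulrDr rmorphD; congr (_ + _).
rewrite mulr_sumr rmorph_sum; apply: eq_bigr => h _ /=.
by case: (hx' h) => s /= ->; rewrite -rmorphM mulrCA.
Qed.
HB.instance Definition _ c := GRing.isSubmodClosed.Build (galg R gT) steinberg
  (Isub c) (Isub_submod_closed c).

Variable K : residue_field (l%:R : R).

Definition steinberg_red := reduction steinberg K.
HB.instance Definition _ := GRing.Lmodule.copy steinberg_red (reduction steinberg K).

Definition Lsub (c : nat) : {pred steinberg_red} := fun v =>
  `[< exists x y : steinberg, x \in Isub c /\ v = red K (x + y *+ l) >].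

Fact Lsub_submod_closed c : submod_closed (Lsub c).
Proof.
split=> [|a v w /asboolP[x [y [hx ->]]] /asboolP[x' [y' [hx' ->]]]].
  by apply/asboolP; exists 0, 0; rewrite rpred0 mul0rn addr0 raddf0.
apply/asboolP; exists (galg_lift a *: x + x'), (galg_lift a *: y + y').
split; first by rewrite rpredD ?rpredZ.
rewrite -{1}[a]galg_liftK red_scale -raddfD; congr (red _ _).
by rewrite scalerDr mulrnDl addrACA scalerMnr.
Qed.
HB.instance Definition _ c := GRing.isSubmodClosed.Build (galg K gT)
  steinberg_red (Lsub c) (Lsub_submod_closed c).

Definition Mquot (c : nat) := quot_lmod (Lsub c.+1).
HB.instance Definition _ c := GRing.Lmodule.copy (Mquot c) (quot_lmod (Lsub c.+1)).

(* M(c) = L(c) / L(c + 1), as the set of cosets v + L(c + 1) with v in L(c),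
   inside L / L(c + 1). *)
Definition Msub (c : nat) : {pred Mquot c} := fun w =>
  `[< exists2 v, v \in Lsub c & w = quot_lmod_pi (Lsub c.+1) v >].

Definition Elam (lam : gT -> R) : steinberg :=
  \sum_(u in unitri) (lam u *: gelt u : galg R gT) *: steinberg_eps.

Definition Flam (lam : gT -> R) : steinberg_red := red K (Elam lam).

Definition Nlam (lam : gT -> R) (c : nat) : {pred Mquot c} := fun w =>
  `[< exists a : galg K gT, w = a *: quot_lmod_pi (Lsub c.+1) (Flam lam) >].

End Filtration.
End Coefficients.
End Steinberg.

Arguments Msub {n F R l} K c.
Arguments Nlam {n F R l} K lam c.

(* Main.v *)
Require Import Defs.
From HB Require Import structures.
From mathcomp Require Import all_boot all_order all_algebra all_fingroup all_field.
From mathcomp Require Import mxrepresentation boolp zify.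
From mathcomp Require classical_sets.

Set Implicit Arguments.
Unset Strict Implicit.
Unset Printing Implicit Defensive.

Import GRing.Theory.
Local Open Scope ring_scope.

(** The Steinberg ideal [I = RG eps] is spanned over [R] by the translates
    [u eps] with [u] unitriangular ([steinberg_span]). Hence, for a linear
    character [lam] of [U], the element [proj lam = \sum_u lam u u] maps [I] into
    the line [R E_lam] ([proj_ideal]): each linear character of [U] occurs just
    once in [I], and the whole proof consists in following these lines through
    the filtration.

    The position of [E_lam] is found by computing the form. By the Bruhat
    decomposition, [f(E_lam, eps)] is a sum over permutations, where only those
    survive that descend along each simple root on which [lam] is non-trivial
    ([sum_character_cap]). The same permutations index the decomposition of [G]
    into double cosets of [P(lam)] and the lower unitriangular group, so that
    [f(E_lam, eps) = [G : P(lam)]] ([parabolic_index], [dot_stE_eps]). Thus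
    [E_lam] lies in [I(c)], but not in [I(c + 1) + l I]. Up to the unit [#|U|], the
    number [[G : P(lam)]] is also the value of the form at [E_lam] and
    [E_(1 / lam)], and these two vectors are exchanged by a diagonal matrix with
    alternating signs.

    For irreducibility, let [w = a E_lam] be non-zero modulo [I(c + 1) + l I].
    Every non-zero [RG]-module contains an eigenvector of [U], because the column
    subgroups can be treated one at a time, from right to left
    ([exists_eigenvector]). So [RG w] contains some [E_mu] that is non-zero
    modulo [I(c + 1) + l I]. As [E_mu] is congruent to an element of [RG E_lam], it
    also lies in [I(c)]; hence [[G : P(mu)]] has valuation [c], and the form
    between [E_(1 / mu)] and [RG E_lam] takes a value of valuation [c]. Some
    translate [x] of [E_(1 / mu)], which belongs to [RG w] too, therefore pairs
    with [E_lam] to a value of valuation [c]. Projecting [x] to the line of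
    [E_(1 / lam)] loses nothing of this value, so the projection is a unit
    multiple of [E_(1 / lam)], and [RG w] contains [E_lam] ([stE_generated]).

    Finally a cyclic module whose generator spans the image of some [e] in the
    group algebra, and lies in all non-zero submodules, is absolutely
    irreducible: the operators [a e b] span all matrices ([line_criterion]). *)

(** * Local coefficient rings *)

Section Ideals.
Variable R : comNzRingType.
Implicit Type r x : R.

(** Zorn's lemma, applied to the proper ideals containing [r]; the empty set is
    allowed as well so that the empty chain has an upper bound. *)
Lemma nonunit_in_maximal r :
  (forall s, r * s <> 1) -> exists2 S : {pred R}, maximal_ideal S & r \in S.
Proof.
move=> nu_r.
pose P (A : classical_sets.set R) := (forall x, ~ A x) \/
  [/\ A r, ~ A 1 & forall a x y, A x -> A y -> A (a * x + y)].
have [|A [PA maxA]] := @classical_sets.Zorn_bigcup R P.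
  move=> C CP totC.
  have [[X CX [x Xx]]|empC] :=
    pselect (exists2 X, C X & exists x, X x); last first.
    left=> x [X CX Xx]; apply: empC; exists X => //; by exists x.
  have ne Y z : C Y -> Y z ->
      [/\ Y r, ~ Y 1 & forall a x y, Y x -> Y y -> Y (a * x + y)].
    by move=> CY Yz; case: (CP Y CY) => // /(_ z).
  right; split.
  - by exists X => //; have [] := ne X x CX Xx.
  - by case=> Y CY Y1; have [_ ] := ne Y 1 CY Y1.
  move=> a y z [Y CY Yy] [Z CZ Zz].
  have [_ _ clY] := ne Y y CY Yy; have [_ _ clZ] := ne Z z CZ Zz.
  have [YZ|ZY] := totC Y Z CY CZ.
    by exists Z => //; apply: clZ => //; apply: YZ.
  by exists Y => //; apply: clY => //; apply: ZY.
have P_rR : P (fun x => exists s, x = r * s).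
  right; split.
  - by exists 1; rewrite mulr1.
  - by case=> s /esym/nu_r.
  by move=> a _ _ [s ->] [t ->]; exists (a * s + t); rewrite mulrDr mulrCA.
have [empA|[Ar nA1 clA]] := PA.
  case: (maxA _ _ P_rR); split=> [x /empA//|sub].
  by apply: (empA r); apply: sub; exists 1; rewrite mulr1.
have A0 : A 0 by rewrite -[0](addNr r) -mulN1r; apply: clA.
exists (fun x => `[< A x >]); last exact/asboolP.
have idA : idealr_closed (fun x => `[< A x >] : bool).
  split; [exact/asboolP | exact/asboolP|].
  by move=> a x y /asboolP Ax /asboolP Ay; apply/asboolP; apply: clA.
split=> // T [T0 T1 clT] sAT x Tx; apply/asboolP; apply: contrapT => nAx.
apply: (maxA (fun x => x \in T)).
  split=> [y Ay|sub]; first by apply: sAT; apply/asboolP.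
  exact/nAx/sub.
right; split=> [|| a y z] //; first by apply/sAT/asboolP.
- exact/negP.
exact: clT.
Qed.

End Ideals.

Section LocalRing.
Variables (R : idomainType) (l : nat).
Hypothesis locR : local_with_maximal_ideal (l%:R : R).

Lemma uniformizer_nonunit s : (l%:R : R) * s <> 1.
Proof.
pose S : {pred R} := fun x => `[< exists s, x = l%:R * s >].
have /(locR S) [[_ nS1 _] _] : forall x, x \in S <-> exists s, x = l%:R * s.
  by move=> x; split=> /asboolP.
by move=> ls1; case/negP: nS1; apply/asboolP; exists s.
Qed.

Lemma local_unit (r : R) : (forall s, r <> l%:R * s) -> r \is a GRing.unit.
Proof.
move=> nlr; apply/negPn/negP=> nu_r.
have [|S maxS Sr] := @nonunit_in_maximal R r.
  by move=> s rs1; case/negP: nu_r; apply/unitrPr; exists s.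
by have /(locR S)/(_ r)[/(_ Sr)[s /nlr]] := maxS.
Qed.

Hypothesis pr_l : prime l.

Lemma local_nat_unit m : ~~ (l %| m)%N -> (m%:R : R) \is a GRing.unit.
Proof.
rewrite -prime_coprime // => co_lm; apply: local_unit => s ms.
have l_gt0 := prime_gt0 pr_l.
have [u v uv _] := egcdnP m l_gt0.
apply: (@uniformizer_nonunit (u%:R - s * v%:R)).
rewrite mulrBr mulrA -ms -natrM mulnC uv (eqP co_lm) natrD mulnC natrM.
by rewrite addrAC subrr add0r.
Qed.

End LocalRing.

(** * Triangular and permutation matrices in the general linear group *)

(** A group together with an identification with the group of invertible
    matrices of size [n.+1]. The group is kept abstract because unification
    would otherwise unfold the multiplication of invertible matrices. *)
Record linear_group (F : finFieldType) (n : nat) := LinearGroup {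
  lg_sort :> finGroupType;
  mx : lg_sort -> 'M[F]_n.+1;
  mx_inj : injective mx;
  mxM : forall g h : lg_sort, mx (g * h)%g = mx g *m mx h;
  mx_surj : forall A, A \in unitmx -> exists g, mx g == A }.
Arguments mx {F n l} g%_g.

Section LinearGroup.
Variables (F : finFieldType) (n : nat) (G : linear_group F n).
Local Notation N := n.+1.
Implicit Types (g h u v : G) (i j k m : 'I_N) (s t : 'S_N) (a b : F).

Definition toGL (A : 'M[F]_N) : G := odflt 1%g [pick g : G | mx g == A].

Lemma toGLK (A : 'M[F]_N) : A \in unitmx -> mx (toGL A) = A.
Proof.
move=> uA; rewrite /toGL; case: pickP => [g /eqP //|no_g].
by have [g gA] := mx_surj G uA; rewrite no_g in gA.
Qed.

End LinearGroup.

Definition root_mx (F : finFieldType) n (i j : 'I_n.+1) (a : F) : 'M[F]_n.+1 :=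
  1%:M + a *: delta_mx i j.

(** Sealed, so that unification never compares the underlying matrices. *)
HB.lock Definition rootGL F n (G : linear_group F n) (i j : 'I_n.+1) (a : F) : G :=
  toGL G (root_mx i j a).
HB.lock Definition permGL F n (G : linear_group F n) (s : 'S_n.+1) : G :=
  toGL G (perm_mx s).
Arguments rootGL {F n} G i j a%_R.
Arguments permGL {F n} G s.

Section Subgroups.
Variables (F : finFieldType) (n : nat) (G : linear_group F n).
Local Notation N := n.+1.
Implicit Types (g h u v : G) (i j k m : 'I_N) (s t : 'S_N) (a b : F).
Local Notation toGL := (@toGL F n G).
Local Notation rootGL := (@rootGL F n G).
Local Notation permGL := (@permGL F n G).

Lemma mx1 : mx (1%g : G) = 1%:M.
Proof.
have e1 := toGLK G (unitmx1 F N).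
rewrite -[RHS]e1; congr (mx _); apply: (mulgI (toGL 1%:M)).
by rewrite mulg1; apply: mx_inj; rewrite mxM e1 mulmx1.
Qed.

Lemma mx_unit g : mx g \in unitmx.
Proof. by have /mulmx1_unit[] : mx g *m mx g^-1 = 1%:M by rewrite -mxM mulgV mx1. Qed.

Lemma mx_det g : \det (mx g) != 0.
Proof. by rewrite -unitfE -unitmxE mx_unit. Qed.

Lemma mxP g h : (forall i j, mx g i j = mx h i j) -> g = h.
Proof. by move=> gh; apply/mx_inj/matrixP. Qed.

Definition lg_borel : {set G} :=
  [set g | [forall i : 'I_N, forall j : 'I_N, (j < i)%N ==> (mx g i j == 0)]].

Definition lg_unitri : {set G} :=
  [set g in lg_borel | [forall i : 'I_N, mx g i i == 1]].

(** The opposite unipotent group, which parametrizes the Bruhat cells. *)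
Definition lower_unitri : {set G} :=
  [set g | [forall i : 'I_N, forall j : 'I_N,
     (i <= j)%N ==> (mx g i j == (i == j)%:R)]].

Lemma borelP g :
  reflect (forall i j, (j < i)%N -> mx g i j = 0) (g \in lg_borel).
Proof.
rewrite inE; apply: (iffP forallP) => [Bg i j lt_ji|Bg i].
  by have /forallP/(_ j)/implyP/(_ lt_ji)/eqP := Bg i.
by apply/forallP=> j; apply/implyP=> /Bg->.
Qed.

Lemma unitriP g :
  reflect (forall i j, (j <= i)%N -> mx g i j = (i == j)%:R)
          (g \in lg_unitri).
Proof.
rewrite inE; apply: (iffP andP) => [[/borelP Bg /forallP g1] i j|g1].
  rewrite leq_eqVlt => /predU1P[/val_inj->|lt_ji].
    by rewrite eqxx (eqP (g1 i)).
  by rewrite Bg // -val_eqE gtn_eqF.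
split; first by apply/borelP=> i j lt_ji; rewrite g1 1?ltnW // -val_eqE gtn_eqF.
by apply/forallP=> i; rewrite g1 ?leqnn // eqxx eqxx.
Qed.

Lemma lower_unitriP g :
  reflect (forall i j, (i <= j)%N -> mx g i j = (i == j)%:R)
          (g \in lower_unitri).
Proof.
rewrite inE; apply: (iffP forallP) => [Lg i j le_ij|Lg i].
  by have /forallP/(_ j)/implyP/(_ le_ij)/eqP := Lg i.
by apply/forallP=> j; apply/implyP=> /Lg->.
Qed.

Lemma unitri_borel u : u \in lg_unitri -> u \in lg_borel.
Proof. by rewrite inE => /andP[]. Qed.

Lemma borel_diag g i : g \in lg_borel -> mx g i i != 0.
Proof.
move=> /borelP Bg; have := mx_det g; rewrite -det_tr det_trig => [|].
  by rewrite prodf_seq_neq0 => /allP/(_ i (mem_index_enum _)); rewrite mxE.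
by apply/is_trig_mxP=> k m lt_km; rewrite mxE Bg.
Qed.

Fact borel_group_set : group_set (lg_borel).
Proof.
apply/group_setP; split=> [|g h /borelP Bg /borelP Bh].
  by apply/borelP=> i j lt_ji; rewrite mx1 mxE -val_eqE gtn_eqF.
apply/borelP=> i j lt_ji; rewrite mxM mxE big1 // => k _.
by case: (ltnP k i) => [/Bg->|le_ik]; rewrite ?mul0r // Bh ?mulr0 // (leq_trans lt_ji).
Qed.
Canonical borel_group := Group borel_group_set.

Fact unitri_group_set : group_set (lg_unitri).
Proof.
apply/group_setP; split=> [|g h Ug Uh].
  by apply/unitriP=> i j _; rewrite mx1 mxE.
have Bgh : (g * h)%g \in lg_borel by rewrite groupM ?unitri_borel.
apply/unitriP=> i j; rewrite leq_eqVlt => /predU1P[/val_inj->|lt_ji].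
  rewrite mxM mxE (bigD1 i) //= (unitriP _ Ug) // (unitriP _ Uh) // eqxx.
  rewrite mulr1 big1 ?addr0 // => k; rewrite -val_eqE neq_ltn => /orP[] lt_k.
    by rewrite (unitriP _ Ug) 1?ltnW // -val_eqE gtn_eqF ?mul0r.
  by rewrite (unitriP _ Uh) 1?ltnW // -val_eqE gtn_eqF ?mulr0.
by rewrite (borelP _ Bgh) // -val_eqE gtn_eqF.
Qed.
Canonical unitri_group := Group unitri_group_set.

Fact lower_unitri_group_set : group_set lower_unitri.
Proof.
apply/group_setP; split=> [|g h Lg Lh].
  by apply/lower_unitriP=> i j _; rewrite mx1 mxE.
apply/lower_unitriP=> i j le_ij; rewrite mxM mxE (bigD1 j) //=.
rewrite (lower_unitriP _ Lg) // (lower_unitriP _ Lh) // eqxx mulr1.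
rewrite big1 ?addr0 // => k kj.
have [le_ik|lt_ki] := leqP i k; last first.
  by rewrite (lower_unitriP _ Lh) ?(negPf kj) ?mulr0 // ltnW ?(leq_trans lt_ki).
rewrite (lower_unitriP _ Lg) //; have [eq_ik|_] := eqVneq i k; last exact: mul0r.
by rewrite (lower_unitriP _ Lh) ?(negPf kj) ?mulr0 // -eq_ik.
Qed.
Canonical lower_unitri_group := Group lower_unitri_group_set.

(** ** Root elements *)

Lemma root_mx_mulE i j a (A : 'M[F]_N) k m :
  (root_mx i j a *m A) k m = A k m + (k == i)%:R * (a * A j m).
Proof.
rewrite mulmxDl mul1mx mxE -scalemxAl; congr (_ + _).
rewrite mxE mxE (bigD1 j) //= mxE eqxx andbT big1 ?addr0; first by rewrite mulrCA.
by move=> k' /negPf nk'; rewrite mxE nk' andbF mul0r.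
Qed.

Lemma mul_root_mxE i j a (A : 'M[F]_N) k m :
  (A *m root_mx i j a) k m = A k m + (m == j)%:R * (A k i * a).
Proof.
rewrite mulmxDr mulmx1 mxE -scalemxAr; congr (_ + _).
rewrite mxE mxE (bigD1 i) //= mxE eqxx /= big1 ?addr0.
  by rewrite mulrA mulrC [a * _]mulrC.
by move=> k' /negPf nk'; rewrite mxE nk' mulr0.
Qed.

Lemma root_mx0 i j : root_mx i j (0 : F) = 1%:M.
Proof. by rewrite /root_mx scale0r addr0. Qed.

Lemma root_mxD i j a b : i != j ->
  root_mx i j a *m root_mx i j b = root_mx i j (a + b).
Proof.
move=> /negPf nij; rewrite /root_mx mulmxDl mul1mx mulmxDr mulmx1.
rewrite -scalemxAl -scalemxAr mul_delta_mx_cond eq_sym nij mulr0n !scaler0 addr0.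
by rewrite scalerDl addrA addrAC.
Qed.

Lemma root_mx_unit i j a : i != j -> root_mx i j a \in unitmx.
Proof.
move=> nij; have : root_mx i j a *m root_mx i j (- a) = 1%:M.
  by rewrite root_mxD // subrr root_mx0.
by case/mulmx1_unit.
Qed.

Lemma rootGLE i j a : i != j -> mx (rootGL i j a) = root_mx i j a.
Proof. by move=> nij; rewrite rootGL.unlock toGLK ?root_mx_unit. Qed.

Lemma rootGL0 i j : rootGL i j 0 = 1%g.
Proof. by apply: mx_inj; rewrite rootGL.unlock toGLK root_mx0 ?unitmx1 ?mx1. Qed.

Lemma rootGLD i j a b : i != j ->
  rootGL i j (a + b) = (rootGL i j a * rootGL i j b)%g.
Proof.
by move=> nij; apply: mx_inj; rewrite mxM !rootGLE // root_mxD.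
Qed.

Lemma rootGLV i j a : i != j -> (rootGL i j a)^-1%g = rootGL i j (- a).
Proof.
move=> nij; apply: (mulgI (rootGL i j a)).
by rewrite mulgV -rootGLD // subrr rootGL0.
Qed.

Lemma rootGL_unitri i j a : (i < j)%N -> rootGL i j a \in lg_unitri.
Proof.
move=> lt_ij; apply/unitriP=> k m le_mk.
rewrite rootGLE; last by rewrite -val_eqE ltn_eqF.
rewrite !mxE; case: andP => [[/eqP ki /eqP mj]|_]; last by rewrite mulr0 addr0.
by move: lt_ij; rewrite -mj -ki ltnNge le_mk.
Qed.

(** The relation [[x_ik, x_kj] = x_ij], in a form free of inverses. *)
Lemma rootGL_commutator i k j a : i != k -> k != j -> i != j ->
  (rootGL i k a * rootGL k j 1%R =
   rootGL i j a * (rootGL k j 1%R * rootGL i k a))%g.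
Proof.
move=> ik kj ij; apply: mx_inj; rewrite !mxM !rootGLE // /root_mx.
rewrite !mulmxDl !mulmxDr !mul1mx !mulmx1.
rewrite -!scalemxAl -!scalemxAr !mul_delta_mx_cond eqxx !scale1r.
rewrite [j == i]eq_sym [j == k]eq_sym (negPf ij) (negPf kj) !mulr0n !scaler0.
rewrite mulmx0 !scaler0 mulr1n !addr0 -!addrA; congr (_ + _).
by rewrite addrCA addrA addrC addrA.
Qed.

(** Peeling off the last non-trivial row of [u], one entry at a time, writes [u]
    as a product of root elements whose positions are those of the non-zero
    entries of [u] above the diagonal. *)
Lemma unitri_ind (Q : G -> Prop) :
    Q 1%g ->
    (forall i j a u, (i < j)%N -> u \in lg_unitri -> mx u i j = 0 ->
       (forall k m, mx (rootGL i j a * u) k m =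
                    if (k == i) && (m == j) then a else mx u k m) ->
     Q u -> Q (rootGL i j a * u)%g) ->
  forall u, u \in lg_unitri -> Q u.
Proof.
move=> Q1 Qstep u.
pose supp u := [set ij : 'I_N * 'I_N | (ij.1 < ij.2)%N & mx u ij.1 ij.2 != 0].
have [r] := ubnP #|supp u|; elim: r u => // r IHr u; rewrite ltnS => le_r Uu.
have [u1|[ij0 ij0u]] := set_0Vmem (supp u).
  suffices -> : u = 1%g by [].
  apply: mxP => i j; rewrite mx1 mxE.
  have [le_ji|lt_ij] := leqP j i; first by rewrite (unitriP _ Uu).
  have : (i, j) \notin supp u by rewrite u1 inE.
  by rewrite inE lt_ij negbK => /eqP->; rewrite -val_eqE ltn_eqF.
have := ij0u; pose P ij := ij \in supp u; rewrite -[_ \in _]/(P ij0) => P0.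
(* Row [j], which is below the last non-trivial row [i], is trivial, so that
   clearing the entry at [i, j] affects no other entry. *)
case: (arg_maxnP (fun ij : 'I_N * 'I_N => ij.1 : nat) P0) => -[i j].
rewrite /P inE /= => /andP[lt_ij uij0] max_i.
have nij : i != j by rewrite -val_eqE ltn_eqF.
have uj m : mx u j m = (j == m)%:R.
  have [le_mj|lt_jm] := leqP m j; first by rewrite (unitriP _ Uu).
  rewrite -val_eqE ltn_eqF //; apply/eqP/negPn/negP => ujm.
  by have := max_i (j, m); rewrite /P inE lt_jm ujm /= leqNgt lt_ij => /(_ isT).
set a := mx u i j in uij0.
pose v := (rootGL i j (- a) * u)%g.
have vE k m : mx v k m = if (k == i) && (m == j) then 0 else mx u k m.
  rewrite /v mxM rootGLE // root_mx_mulE uj.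
  have [->|] := eqVneq k i; rewrite ?mul0r ?addr0 //= mul1r.
  rewrite eq_sym; have [->|] := eqVneq m j; rewrite ?mulr0 ?addr0 //.
  by rewrite mulr1 subrr.
have Uv : v \in lg_unitri.
  exact: groupM (rootGL_unitri _ lt_ij) Uu.
have uv : u = (rootGL i j a * v)%g by rewrite mulgA -rootGLD // subrr rootGL0 mul1g.
have Pv : Q v.
  apply: IHr => //; apply: leq_trans le_r; apply: proper_card; apply/properP.
  split.
    apply/subsetP=> -[k m]; rewrite !inE /= vE => /andP[-> /=].
    by case: ifP; rewrite ?eqxx.
  by exists (i, j); rewrite !inE lt_ij //= vE !eqxx.
rewrite uv; apply: Qstep => // [|k m]; first by rewrite vE !eqxx.
by rewrite -uv vE; case: ifP => [/andP[/eqP-> /eqP->]|->].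
Qed.

(** ** Permutation matrices and diagonal matrices *)

Lemma permGLE s : mx (permGL s) = perm_mx s.
Proof. by rewrite permGL.unlock toGLK ?unitmx_perm. Qed.

Lemma permGLM s t : permGL (s * t)%g = (permGL s * permGL t)%g.
Proof. by apply: mx_inj; rewrite mxM !permGLE perm_mxM. Qed.

Lemma permGL1 : permGL 1 = 1%g.
Proof. by apply: mx_inj; rewrite permGLE perm_mx1 mx1. Qed.

Lemma permGLV s : permGL s^-1 = (permGL s)^-1%g.
Proof. by apply/eqP; rewrite eq_sym eq_invg_mul -permGLM mulgV permGL1. Qed.

Lemma permGL_mulE s g i j : mx (permGL s * g)%g i j = mx g (s i) j.
Proof. by rewrite mxM permGLE -row_permE mxE. Qed.

Lemma mul_permGLE s g i j : mx (g * permGL s)%g i (s j) = mx g i j.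
Proof. by rewrite mxM permGLE -[s]invgK -col_permE mxE invgK permK. Qed.

Lemma permGL_conjE s g i j :
  mx (permGL s * g * (permGL s)^-1) i j = mx g (s i) (s j).
Proof.
by rewrite -permGLV -{1}[j](permK s) mul_permGLE permGL_mulE.
Qed.

Lemma permGL_tpermK i j : (permGL (tperm i j) * permGL (tperm i j) = 1)%g.
Proof. by rewrite -permGLM tperm2 permGL1. Qed.

Definition diagGL : pred G := fun g => is_diag_mx (mx g).

Lemma diagGL_borel g : diagGL g -> g \in lg_borel.
Proof.
move/is_diag_mxP=> Dg; apply/borelP=> i j lt_ji.
by rewrite Dg // neq_ltn lt_ji orbT.
Qed.

Lemma diagGL_conj s g : diagGL g -> diagGL ((permGL s)^-1 * g * permGL s)%g.
Proof.
move/is_diag_mxP=> Dg; apply/is_diag_mxP => i j nij.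
rewrite -[s]invgK permGLV invgK permGL_conjE Dg //.
by rewrite val_eqE (inj_eq perm_inj) -val_eqE.
Qed.

(** The matrix [h] below is the identity outside rows and columns [i] and [j];
    inside, the identity is the familiar one in GL_2. *)
Lemma rank_one_relation i j a : i != j -> a != 0 ->
  exists2 h, diagGL h &
   (permGL (tperm i j) * rootGL i j a * permGL (tperm i j) =
    rootGL i j a^-1 * h * permGL (tperm i j) * rootGL i j a^-1)%g.
Proof.
move=> nij a0; set s := permGL (tperm i j).
have ss : (s * s = 1)%g by apply: permGL_tpermK.
pose h := (rootGL i j (- a^-1) * (s * rootGL i j a * s) *
          rootGL i j (- a^-1) * s)%g.
exists h; last first.
  by rewrite /h -rootGLV // -!mulgA mulVKg (mulgA s s) ss mul1g mulVg mulg1.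
have nji : j != i by rewrite eq_sym.
have sxs : (s * rootGL i j a * s = rootGL j i a)%g.
  have sV : s = (s^-1)%g by apply/eqP; rewrite eq_sym eq_invg_mul ss.
  apply: mxP => k m; rewrite {2}sV permGL_conjE !rootGLE // !mxE.
  rewrite (inj_eq perm_inj); congr (_ + _ * (_ && _)%:R).
    by rewrite -{2}[i](tpermR i j) (inj_eq perm_inj).
  by rewrite -{2}[j](tpermL i j) (inj_eq perm_inj).
apply/is_diag_mxP=> k m; rewrite /h sxs val_eqE => nkm.
rewrite -[m](tpermK i j) mul_permGLE.
rewrite !mxM !rootGLE // mul_root_mxE !root_mx_mulE !mxE !eqxx.
rewrite -[m in k != m](tpermK i j) in nkm.
move: {m}(tperm i j m) nkm => m.
case: tpermP => [->|->|/eqP mi /eqP mj] nkm.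
- rewrite (negPf nkm) (negPf nij) (negPf nji) !eqxx /=.
  by rewrite !(mulr0, mul0r, addr0, add0r, mulr1) mulNr mulVf // mulrN1 subrr.
- rewrite (negPf nkm) (negPf nji) !eqxx !(andbT, andbF) /=.
  rewrite !(mulr0, mul0r, addr0, add0r, mul1r) mulrN mulrAC divff //.
  by rewrite mul1r subrr.
rewrite (negPf mi) (negPf mj) [j == m]eq_sym (negPf mj) (negPf nkm) !andbF.
by rewrite !(mul0r, mulr0, addr0).
Qed.

End Subgroups.
Arguments lg_borel {F n} G.
Arguments lg_unitri {F n} G.
Arguments lower_unitri {F n} G.

(** * Generation by the Borel subgroup and the simple reflections *)

Section Generation.
Variables (F : finFieldType) (n : nat) (G : linear_group F n).
Local Notation N := n.+1.

Local Notation permGL := (@permGL F n G).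

(** The LUP decomposition reduces to permutations, upper triangular matrices
    and lower unitriangular ones; the last are conjugate to upper triangular
    ones by the longest permutation. *)
Lemma GL_ind (Q : G -> Prop) :
    Q 1%g ->
    (forall b g, b \in lg_borel G -> Q g -> Q (b * g)%g) ->
    (forall (i j : 'I_N) g, j = i.+1 :> nat -> Q g ->
       Q (permGL (tperm i j) * g)%g) ->
  forall g, Q g.
Proof.
move=> Q1 Qb Qs g.
pose st h := forall g, Q g -> Q (h * g)%g.
have stM h h' : st h -> st h' -> st (h * h')%g.
  by move=> sth sth' k Qk; rewrite -mulgA; apply/sth/sth'.
suff: st g by move/(_ _ Q1); rewrite mulg1.
have st1 : st 1%g by move=> k; rewrite mul1g.
have stT d : forall i j : 'I_N, j = (i + d)%N :> nat -> st (permGL (tperm i j)).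
  elim: d => [|d IHd] i j ji.
    by rewrite (_ : j = i) ?tperm1 ?permGL1 //; apply: val_inj; rewrite /= ji addn0.
  have lt_k : (i + d < N)%N by apply: leq_trans (ltn_ord j); rewrite ji addnS.
  pose k : 'I_N := Ordinal lt_k.
  have jk : j = k.+1 :> nat by rewrite ji addnS.
  have st_kj : st (permGL (tperm k j)) by move=> h; apply: Qs.
  have [d0|d_gt0] := posnP d.
    by rewrite (_ : i = k) //; apply: val_inj; rewrite /= d0 addn0.
  have ki : k != i by rewrite -val_eqE /= -{2}[val i]addn0 eqn_add2l -lt0n.
  have jni : j != i by rewrite -val_eqE /= jk gtn_eqF // ltnS leq_addr.
  have -> : tperm i j = (tperm k j * tperm i k * tperm k j)%g.
    rewrite -{1}[tperm k j]tpermV -mulgA -/(conjg _ _) tpermJ tpermL.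
    by rewrite tpermD // eq_sym.
  by rewrite !permGLM; apply: (stM _ _ (stM _ _ _ _)) => //; apply: IHd.
have stS s : st (permGL s).
  have [ts -> _] := prod_tpermP s.
  elim: ts => [|[i j] ts IHts]; first by rewrite big_nil permGL1.
  rewrite big_cons permGLM; apply: (stM) => //=.
  case: (leqP i j) => [le_ij|/ltnW le_ji]; first by apply: (stT (j - i)%N); rewrite subnKC.
  by rewrite tpermC; apply: (stT (i - j)%N); rewrite subnKC.
have stB b : b \in lg_borel G -> st b by move=> Bb h; apply: Qb.
have stL h : h \in lower_unitri G -> st h.
  move=> /lower_unitriP Lh; pose w : 'S_N := perm (@rev_ord_inj N).
  have -> : h = ((permGL w)^-1 * (permGL w * h * (permGL w)^-1) * permGL w)%g.
    by rewrite !mulgA mulVg mul1g mulgKV.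
  rewrite -permGLV; apply: (stM _ _ _ (stS _)); apply: (stM _ _ (stS _)); apply: stB.
  apply/borelP=> i j lt_ji; rewrite permGLV permGL_conjE Lh.
    by rewrite (inj_eq perm_inj) -val_eqE gtn_eqF.
  by rewrite !permE /= leq_sub2l // ltnW.
have := cormen_lup_correct (mx g); have := cormen_lup_perm (mx g).
have := @cormen_lup_lower F _ (mx g); have := @cormen_lup_upper F _ (mx g).
case: cormen_lup => [[P L] U] /= Uup Llow /is_perm_mxP[s Ps] PgLU.
have : mx (permGL s * g) \in unitmx by apply: mx_unit.
rewrite mxM permGLE -Ps mulmxE PgLU -mulmxE unitmx_mul => /andP[uL uU].
have -> : g = (permGL s^-1 * (toGL G L * toGL G U))%g.
  apply: (mulgI (permGL s)); rewrite mulgA -permGLM mulgV permGL1 mul1g.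
  by apply: mx_inj; rewrite !mxM permGLE -Ps !toGLK.
apply: (stM _ _ (stS _)); apply: (stM); last first.
  by apply: stB; apply/borelP=> i j lt_ji; rewrite toGLK ?Uup.
by apply: stL; apply/lower_unitriP=> i j le_ij; rewrite toGLK ?Llow.
Qed.

End Generation.

(** * Linear characters of the unitriangular group *)

Section UnitriangularCharacters.
Variables (F : finFieldType) (n : nat) (G : linear_group F n) (R : idomainType).
Local Notation N := n.+1.
Local Notation U := (lg_unitri G).
Implicit Types (u v : G) (a b : F) (i j k m : 'I_N).
Definition linear_character (lam : G -> R) : Prop :=
  {in U, forall u, lam u \is a GRing.unit} /\
  {in U &, {morph lam : u v / (u * v)%g >-> u * v}}.

Variable lam : G -> R.
Hypothesis lamU : linear_character lam.

Lemma character_unit u : u \in U -> lam u \is a GRing.unit.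
Proof. by case: lamU => + _; apply. Qed.

Lemma characterM u v : u \in U -> v \in U -> lam (u * v)%g = lam u * lam v.
Proof. by case: lamU => _ + Uu Uv; apply. Qed.

Lemma character1 : lam 1%g = 1.
Proof.
have U1 := group1 (unitri_group G).
by apply: (mulrI (character_unit U1)); rewrite -characterM // mulg1 mulr1.
Qed.

Lemma characterV u : u \in U -> lam u^-1%g = (lam u)^-1.
Proof.
move=> Uu; apply: (mulrI (character_unit Uu)).
by rewrite -characterM ?groupV // mulgV character1 divrr ?character_unit.
Qed.

(** A root element off the superdiagonal is a commutator. *)
Lemma character_nonsimple_root (i j : 'I_N) a : (i.+1 < j)%N ->
  lam (rootGL G i j a) = 1.
Proof.
move=> lt_ij.
have lt_k : (i.+1 < N)%N by apply: ltn_trans (ltn_ord j).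
pose k := Ordinal lt_k.
have Ur (i' j' : 'I_N) b : (i' < j')%N -> rootGL G i' j' b \in U by apply: rootGL_unitri.
have lt_ij' : (i < j)%N by apply: ltnW.
have := @rootGL_commutator F n G i k j a.
rewrite -!val_eqE /= !ltn_eqF // => /(_ isT isT isT) /(congr1 lam).
rewrite !characterM ?groupM ?Ur //= [lam (rootGL G k j _) * _]mulrC.
rewrite -{1}[_ * lam _]mul1r => /mulIr -> //.
by rewrite unitrMl ?character_unit ?Ur /=.
Qed.

(** By [unitri_ind], [u] is a product of root elements at the positions of its
    non-zero entries. *)
Lemma character_support u : u \in U ->
    (forall i j : 'I_N, (i < j)%N -> mx u i j != 0 ->
       lam (rootGL G i j (mx u i j)) = 1) ->
  lam u = 1.
Proof.
move: u; apply: unitri_ind => [_|i j a u lt_ij Uu uij0 auE IHu triv].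
  exact: character1.
rewrite characterM ?rootGL_unitri // IHu ?mulr1.
  have [->|a0] := eqVneq a 0; first by rewrite rootGL0 character1.
  by have := triv i j lt_ij; rewrite auE !eqxx => /(_ a0).
move=> k m lt_km ukm; have := triv k m lt_km; rewrite auE.
case: ifP => [/andP[/eqP kE /eqP mE]|_ -> //].
by rewrite kE mE uij0 eqxx in ukm.
Qed.

End UnitriangularCharacters.

(** ** The torus element inverting all linear characters *)

Section AlternatingTorus.
Variables (F : finFieldType) (n : nat) (G : linear_group F n).
Local Notation N := n.+1.
Local Notation U := (lg_unitri G).
Implicit Types (u v : G) (a b : F) (i j k m : 'I_N).

(** A diagonal matrix for which all ratios of consecutive entries are [-1]. *)
Definition alternating_mx : 'M[F]_N := diag_mx (\row_i (-1) ^+ i).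

Lemma alternating_mxK : alternating_mx *m alternating_mx = 1%:M.
Proof.
apply/matrixP=> i j; rewrite mul_diag_mx !mxE mulrnAr -expr2 sqrr_sign.
by [].
Qed.

Definition alternating : G := toGL G alternating_mx.

Lemma alternatingE : mx alternating = alternating_mx.
Proof. by rewrite toGLK //; case: (mulmx1_unit alternating_mxK). Qed.

Lemma alternatingK : (alternating * alternating = 1)%g.
Proof. by apply: mx_inj; rewrite mxM alternatingE alternating_mxK mx1. Qed.

Lemma alternating_diag : diagGL alternating.
Proof. by rewrite /diagGL alternatingE diag_mx_is_diag. Qed.

Lemma alternating_conjE u i j :
  mx (alternating * u * alternating) i j =
  (-1) ^+ i * mx u i j * (-1) ^+ j.
Proof.
by rewrite !mxM alternatingE mul_mx_diag mul_diag_mx !mxE.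
Qed.

Lemma alternating_conj_unitri u :
  u \in U -> (alternating * u * alternating)%g \in U.
Proof.
move=> Uu; apply/unitriP=> i j le_ji; rewrite alternating_conjE (unitriP _ Uu) //.
have [->|] := eqVneq i j; last by rewrite mulr0 mul0r.
by rewrite mulr1 -expr2 sqrr_sign.
Qed.

Lemma alternating_conj_root i j a : i != j ->
  (alternating * rootGL G i j a * alternating = rootGL G i j ((-1) ^+ (i + j) * a))%g.
Proof.
move=> nij; apply: mxP => k m; rewrite alternating_conjE !rootGLE // !mxE.
rewrite mulrDr mulrDl; congr (_ + _).
  have [->|_] := eqVneq k m; last by rewrite mulr0 mul0r.
  by rewrite mulr1 -expr2 sqrr_sign.
case: andP => [[/eqP-> /eqP->]|_]; last by rewrite !mulr0 mul0r.
by rewrite !mulr1 exprD mulrAC.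
Qed.

Variables (R : idomainType) (lam : G -> R).
Hypothesis lamU : linear_character lam.

(** Conjugation by the alternating torus element negates the superdiagonal. *)
Lemma character_alternating u : u \in U ->
  lam (alternating * u * alternating)%g * lam u = 1.
Proof.
move: u; apply: unitri_ind => [|i j a u lt_ij Uu _ _ IHu].
  by rewrite mulg1 alternatingK (character1 lamU) mulr1.
have Ux b : rootGL G i j b \in U by apply: rootGL_unitri.
have nij : i != j by rewrite -val_eqE ltn_eqF.
set t := alternating in IHu *.
have -> : (t * (rootGL G i j a * u) * t =
           (t * rootGL G i j a * t) * (t * u * t))%g.
  by rewrite -!mulgA (mulgA t t) alternatingK mul1g.
rewrite alternating_conj_root // !(characterM lamU (Ux _)) ?alternating_conj_unitri //.
rewrite mulrACA IHu mulr1 -(characterM lamU) //.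
have [le_ji|lt_ij2] := leqP j i.+1; last first.
  by rewrite (characterM lamU) // !(character_nonsimple_root lamU) ?mulr1.
have -> : (j : nat) = i.+1 by apply/eqP; rewrite eqn_leq le_ji.
rewrite -rootGLD // addnS addnn exprS -signr_odd odd_double mulr1 mulN1r addNr.
by rewrite rootGL0 (character1 lamU).
Qed.

End AlternatingTorus.

(** * The group algebra as an algebra *)

Section GroupAlgebra.
Variables (R : comNzRingType) (gT : finGroupType).
Local Notation A := (galg R gT).
Implicit Types (x y a : A) (r : R) (g h : gT).

Lemma galgZ r x g : galg_coef (r *: x) g = r * x g.
Proof. by rewrite /galg_coef ffunE. Qed.

Lemma galg_sum (I : Type) (s : seq I) (P : pred I) (f : I -> A) g :
  galg_coef (\sum_(i <- s | P i) f i) g = \sum_(i <- s | P i) f i g.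
Proof.
by apply: (big_morph (fun x : A => x g)) => [x y|]; [apply: galgD | apply: galg0].
Qed.

Lemma galgMZl r x y : (r *: x) * y = r *: (x * y).
Proof.
apply: galgP => g; rewrite galgZ !galg_mulE mulr_sumr.
by apply: eq_bigr => h _; rewrite galgZ mulrA.
Qed.

Lemma galgMZr r x y : x * (r *: y) = r *: (x * y).
Proof.
apply: galgP => g; rewrite galgZ !galg_mulE mulr_sumr.
by apply: eq_bigr => h _; rewrite galgZ mulrCA.
Qed.

Lemma geltM g h : gelt g * gelt h = gelt (g * h) :> A.
Proof. exact: galg_mul_geltM. Qed.

Lemma geltMA g h x : gelt g * (gelt h * x) = gelt (g * h) * x.
Proof. by rewrite mulrA geltM. Qed.

Lemma gelt1M x : gelt 1%g * x = x.
Proof. exact: mul1r. Qed.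

Lemma gelt_mulE g x h : galg_coef (gelt g * x) h = x (g^-1 * h)%g.
Proof. exact: galg_mul_gelt. Qed.

Lemma galg_expand x : x = \sum_g x g *: gelt g.
Proof.
apply: galgP => h; rewrite galg_sum (bigD1 h) //= galgZ geltE eqxx mulr1.
by rewrite big1 ?addr0 // => g ng; rewrite galgZ geltE eq_sym (negPf ng) mulr0.
Qed.

Lemma hatE (S : {set gT}) g : galg_coef (\sum_(s in S) gelt s : A) g = (g \in S)%:R.
Proof.
rewrite galg_sum; have [Sg|nSg] := boolP (g \in S).
  rewrite (bigD1 g) //= geltE eqxx big1 ?addr0 // => h /andP[_ nh].
  by rewrite geltE eq_sym (negPf nh).
rewrite big1 // => h Sh; rewrite geltE (_ : g == h = false) //.
by apply: contraNF nSg => /eqP->.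
Qed.

Lemma gelt_hat (B : {group gT}) b : b \in B ->
  gelt b * (\sum_(s in B) gelt s) = \sum_(s in B) gelt s :> A.
Proof.
move=> Bb; apply: galgP => g; rewrite gelt_mulE !hatE.
by rewrite groupMl ?groupV.
Qed.

End GroupAlgebra.

(** * The Steinberg ideal is spanned by the unitriangular translates of eps *)

Section SimpleReflections.
Variables (F : finFieldType) (n : nat) (G : linear_group F n).
Local Notation N := n.+1.
Local Notation U := (lg_unitri G).
Local Notation B := (lg_borel G).
Implicit Types (g h u v b : G) (i j k m : 'I_N) (s t : 'S_N) (a : F).
Local Notation permGL := (@permGL F n G).

(** A simple reflection makes only one positive root negative. *)
Lemma simple_tperm_lt i j k m : j = i.+1 :> nat -> (m < k)%N ->
  (tperm i j m < tperm i j k)%N \/ (k = j /\ m = i).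
Proof.
move=> ji lt_mk; case: tpermP => [mi|mj|/eqP mi /eqP mj].
- case: tpermP => [ki|kj|/eqP ki /eqP kj]; subst; first by rewrite ltnn in lt_mk.
    by right.
  by left; move: ki kj; rewrite -!val_eqE /=; lia.
- case: tpermP => [ki|kj|/eqP ki /eqP kj]; subst; first by lia.
    by rewrite ltnn in lt_mk.
  by left; lia.
by case: tpermP => [ki|kj|/eqP ki /eqP kj]; subst; left;
  move: mi mj; rewrite -!val_eqE /=; lia.
Qed.

Lemma permGL_tpermV i j : ((permGL (tperm i j))^-1 = permGL (tperm i j))%g.
Proof. by rewrite -permGLV tpermV. Qed.

Lemma simple_conj_borel i j b : j = i.+1 :> nat -> b \in B ->
    mx b i j = 0 ->
  (permGL (tperm i j) * b * permGL (tperm i j))%g \in B.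
Proof.
move=> ji Bb bij; apply/borelP=> k m lt_mk.
rewrite -{2}permGL_tpermV permGL_conjE.
have [lt|[-> ->]] := simple_tperm_lt ji lt_mk; first by rewrite (borelP _ Bb).
by rewrite tpermL tpermR.
Qed.

Lemma simple_conj_unitri i j u : j = i.+1 :> nat -> u \in U ->
    mx u i j = 0 ->
  (permGL (tperm i j) * u * permGL (tperm i j))%g \in U.
Proof.
move=> ji Uu uij; apply/unitriP=> k m; rewrite leq_eqVlt.
rewrite -{2}permGL_tpermV permGL_conjE => /predU1P[/val_inj->|lt_mk].
  by rewrite (unitriP _ Uu) // !eqxx.
have [lt|[-> ->]] := simple_tperm_lt ji lt_mk.
  by rewrite (unitriP _ Uu) 1?ltnW // (inj_eq perm_inj).
by rewrite tpermL tpermR uij -val_eqE /= ji gtn_eqF.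
Qed.

(** Splitting off a simple root subgroup leaves a subgroup normalized by the
    corresponding reflection. *)
Lemma borel_simple_split i j b : j = i.+1 :> nat -> b \in B ->
  exists b' a, [/\ b = (b' * rootGL G i j a)%g,
    (permGL (tperm i j) * b' * permGL (tperm i j))%g \in B &
    b \in U -> (permGL (tperm i j) * b' * permGL (tperm i j))%g \in U].
Proof.
move=> ji Bb; have lt_ij : (i < j)%N by rewrite ji.
have nij : i != j by rewrite -val_eqE ltn_eqF.
have Ux c : rootGL G i j c \in U by apply: rootGL_unitri.
have bii := borel_diag i Bb; pose a := mx b i j / mx b i i.
exists (b * rootGL G i j (- a))%g, a.
have b'ij : mx (b * rootGL G i j (- a))%g i j = 0.
  by rewrite mxM rootGLE // mul_root_mxE eqxx mul1r mulrN mulrC divfK // subrr.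
split=> [||Ub]; first by rewrite -mulgA -rootGLD // addNr rootGL0 mulg1.
  by apply: simple_conj_borel => //; rewrite groupM // unitri_borel.
by apply: simple_conj_unitri => //; rewrite groupM.
Qed.

Lemma borel_torus_split b : b \in B ->
  exists u h, [/\ u \in U, diagGL h & b = (u * h)%g].
Proof.
move=> Bb; pose D : 'M[F]_N := diag_mx (\row_i mx b i i).
have uD : D \in unitmx.
  rewrite unitmxE det_diag unitfE prodf_seq_neq0.
  by apply/allP=> i _ /=; rewrite mxE borel_diag.
have dh : diagGL (toGL G D) by rewrite /diagGL toGLK // diag_mx_is_diag.
have Bu : (b * (toGL G D)^-1)%g \in B by rewrite groupM ?groupV // diagGL_borel.
exists (b * (toGL G D)^-1)%g, (toGL G D); split; rewrite ?mulgKV //.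
have uE i j : mx (b * (toGL G D)^-1)%g i j * mx b j j = mx b i j.
  rewrite -[in RHS](mulgKV (toGL G D) b) [in RHS]mxM toGLK //.
  by rewrite mul_mx_diag !mxE.
apply/unitriP=> i j; rewrite leq_eqVlt => /predU1P[/val_inj->|lt_ji].
  by apply: (mulIf (borel_diag i Bb)); rewrite uE eqxx mul1r.
by rewrite (borelP _ Bu) // -val_eqE gtn_eqF.
Qed.

End SimpleReflections.

Section SteinbergSpan.
Variables (F : finFieldType) (n : nat) (G : linear_group F n) (R : idomainType).
Local Notation N := n.+1.
Local Notation U := (lg_unitri G).
Local Notation B := (lg_borel G).
Local Notation A := (galg R G).
Local Notation permGL := (@permGL F n G).
Implicit Types (g h u v b : G) (i j k m : 'I_N) (s t : 'S_N) (a : F).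
Implicit Types (x y z : A) (r : R).

Local Notation refl i j := (permGL (tperm i j)).

Definition bhat : A := \sum_(b in B) gelt b.

(** The element [eps] and the ideal it generates, over an abstract linear group. *)
Definition st_eps : A :=
  \sum_(s : 'S_N) (-1) ^+ s *: (gelt (permGL s) * bhat).
Local Notation eps := st_eps.

Definition st_ideal x : Prop := exists a : A, x = a * eps.

Lemma gelt_bhat b : b \in B -> gelt b * bhat = bhat.
Proof. exact: (@gelt_hat R G (borel_group G)). Qed.

(** [gelt g * bhat] only depends on the coset of [g]. *)
Lemma gelt_perm_bhat g s : ((permGL s)^-1 * g * permGL s)%g \in B ->
  gelt g * (gelt (permGL s) * bhat) = gelt (permGL s) * bhat.
Proof.
by move=> Bg; rewrite -{2}(gelt_bhat Bg) !geltMA !mulgA mulgV mul1g.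
Qed.

Lemma torus_eps h : diagGL h -> gelt h * eps = eps.
Proof.
move=> dh; rewrite /st_eps mulr_sumr; apply: eq_bigr => s _.
by rewrite galgMZr gelt_perm_bhat // diagGL_borel // diagGL_conj.
Qed.

Lemma refl_eps i j : i != j -> gelt (refl i j) * eps = - eps.
Proof.
move=> nij; rewrite /st_eps mulr_sumr -sumrN (reindex_inj (mulgI (tperm i j))) /=.
apply: eq_bigr => s _; rewrite galgMZr geltMA -permGLM mulgA tperm2 mul1g.
by rewrite odd_mul_tperm nij /= signrN scaleNr.
Qed.

Lemma permGL_conjVE s g i j :
  mx ((permGL s)^-1 * g * permGL s)%g (s i) (s j) = mx g i j.
Proof. by rewrite -permGLV mul_permGLE permGL_mulE permK. Qed.

(** The half of [eps] fixed by the root subgroup of [i, j]; the other half is its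
    translate by the reflection. *)
Definition half_eps i j : A :=
  \sum_(s : 'S_N | (s i < s j)%N) (-1) ^+ s *: (gelt (permGL s) * bhat).

Lemma eps_half i j : i != j ->
  eps = half_eps i j - gelt (refl i j) * half_eps i j.
Proof.
move=> nij; rewrite /st_eps (bigID (fun s : 'S_N => (s i < s j)%N)) /=; congr (_ + _).
rewrite /half_eps mulr_sumr -sumrN (reindex_inj (mulgI (tperm i j))) /=.
apply: eq_big => [s|s _].
  rewrite !permM tpermL tpermR -leqNgt leq_eqVlt (inj_eq val_inj).
  by rewrite (inj_eq perm_inj) (negPf nij).
by rewrite galgMZr geltMA -permGLM odd_mul_tperm nij /= signrN scaleNr.
Qed.

Lemma root_half i j a : i != j ->
  gelt (rootGL G i j a) * half_eps i j = half_eps i j.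
Proof.
move=> nij; rewrite /half_eps mulr_sumr; apply: eq_bigr => s lt_s.
rewrite galgMZr gelt_perm_bhat //; apply/borelP=> k m.
rewrite -[k](permKV s) -[m](permKV s); set k' := _ k; set m' := _ m => lt_mk.
rewrite permGL_conjVE rootGLE // !mxE; case: andP => [[/eqP ki /eqP mj]|_].
  by move: lt_mk; rewrite ki mj ltnNge ltnW.
rewrite mulr0 addr0; have [km|//] := eqVneq k' m'.
by rewrite km ltnn in lt_mk.
Qed.

Lemma torus_half h i j : diagGL h -> gelt h * half_eps i j = half_eps i j.
Proof.
move=> dh; rewrite /half_eps mulr_sumr; apply: eq_bigr => s _.
by rewrite galgMZr gelt_perm_bhat // diagGL_borel // diagGL_conj.
Qed.

(** Conjugating the rank one relation by the fixed vector [half_eps]. *)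
Lemma refl_root_eps i j a : i != j -> a != 0 ->
  gelt (refl i j * rootGL G i j a)%g * eps =
  gelt (rootGL G i j a^-1) * eps - eps.
Proof.
move=> nij a0; have [h dh sxs] := rank_one_relation G nij a0.
set x := half_eps i j.
have sxsx : gelt (refl i j * rootGL G i j a)%g * (gelt (refl i j) * x) =
            gelt (rootGL G i j a^-1) * (gelt (refl i j) * x).
  rewrite geltMA sxs -(geltMA _ (rootGL G i j a^-1)) {}/x (root_half _ nij).
  rewrite -mulgA -geltMA -[(h * _)%g](mulVKg (refl i j)) -geltMA.
  by rewrite [((refl i j)^-1 * _)%g]mulgA torus_half ?diagGL_conj.
rewrite (eps_half nij) -/x mulrBr sxsx -(geltMA (refl i j) (rootGL G i j a)).
rewrite mulrBr {1 2}/x !(root_half _ nij) -/x opprB addrCA addrA.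
by rewrite [x - _]addrC addrA addrK.
Qed.

Definition Uspan x := exists r : G -> R, x = \sum_(u in U) r u *: (gelt u * eps).

Lemma UspanD x y : Uspan x -> Uspan y -> Uspan (x + y).
Proof.
move=> [r ->] [r' ->]; exists (fun u => r u + r' u); rewrite -big_split /=.
by apply: eq_bigr => u _; rewrite scalerDl.
Qed.

Lemma UspanZ r x : Uspan x -> Uspan (r *: x).
Proof.
move=> [r' ->]; exists (fun u => r * r' u); rewrite scaler_sumr.
by apply: eq_bigr => u _; rewrite scalerA.
Qed.

Lemma UspanN x : Uspan x -> Uspan (- x).
Proof. by rewrite -scaleN1r; apply: UspanZ. Qed.

Lemma Uspan_sum (I : Type) (e : seq I) (P : pred I) (f : I -> A) :
  (forall c, P c -> Uspan (f c)) -> Uspan (\sum_(c <- e | P c) f c).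
Proof.
move=> Uf; elim/big_rec: _ => [|i x /Uf Ufi Ux]; last exact: UspanD.
by exists (fun=> 0); rewrite big1 // => u _; rewrite scale0r.
Qed.

Lemma Uspan_gelt u : u \in U -> Uspan (gelt u * eps).
Proof.
move=> Uu; exists (fun v => (v == u)%:R).
rewrite (bigD1 u) //= eqxx scale1r big1 ?addr0 // => v /andP[_ /negPf->].
by rewrite scale0r.
Qed.

Lemma Uspan_eps : Uspan eps.
Proof. by rewrite -[eps]gelt1M; apply/Uspan_gelt/(group1 (unitri_group G)). Qed.

Lemma Uspan_transl g x : (forall u, u \in U -> Uspan (gelt (g * u)%g * eps)) ->
  Uspan x -> Uspan (gelt g * x).
Proof.
move=> Ug [r ->]; rewrite mulr_sumr; apply: Uspan_sum => u Uu.
by rewrite galgMZr geltMA; apply/UspanZ/Ug.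
Qed.

(** By induction on [g] as a product of Borel elements and simple reflections; a
    reflection is moved past [u] up to one root element, where
    [refl_root_eps] applies. *)
Lemma Uspan_translate g : Uspan (gelt g * eps).
Proof.
move: g; apply: GL_ind => [|b g Bb|i j g ji].
- by rewrite gelt1M; apply: Uspan_eps.
- rewrite -geltMA; apply: Uspan_transl => u Uu.
  have [v [h [Uv dh ->]]] : exists v h, [/\ v \in U, diagGL h & (b * u = v * h)%g].
    by apply: borel_torus_split; rewrite groupM // unitri_borel.
  by rewrite -geltMA torus_eps //; apply: Uspan_gelt.
rewrite -geltMA; apply: Uspan_transl => u Uu.
have nij : i != j by rewrite -val_eqE /= ji ltn_eqF.
have [v [a [uE _ /(_ Uu) Uv]]] := borel_simple_split ji (unitri_borel Uu).
rewrite uE.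
set w := (_ * v * _)%g in Uv.
have -> : (refl i j * (v * rootGL G i j a) = w * (refl i j * rootGL G i j a))%g.
  by rewrite /w -[RHS]mulgA (mulgA (refl i j) (refl i j)) permGL_tpermK mul1g !mulgA.
rewrite -geltMA; apply: Uspan_transl => [v' Uv'|].
  by apply: Uspan_gelt; rewrite groupM.
have [->|a0] := eqVneq a 0.
  by rewrite rootGL0 mulg1 refl_eps //; apply/UspanN/Uspan_eps.
rewrite refl_root_eps //; apply: UspanD; last exact/UspanN/Uspan_eps.
by apply: Uspan_gelt; apply: rootGL_unitri; rewrite ji.
Qed.

Lemma steinberg_span x : st_ideal x -> Uspan x.
Proof.
case=> y ->; rewrite [y]galg_expand mulr_suml.
by apply: Uspan_sum => g _; rewrite galgMZl; apply/UspanZ/Uspan_translate.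
Qed.

End SteinbergSpan.

(** * Bruhat decomposition and the index of a parabolic subgroup *)

Section Bruhat.
Variables (F : finFieldType) (n : nat) (G : linear_group F n).
Local Notation N := n.+1.
Local Notation U := (lg_unitri G).
Local Notation B := (lg_borel G).
Local Notation L := (lower_unitri G).
Local Notation permGL := (@permGL F n G).
Implicit Types (g h u v b : G) (i j k m : 'I_N) (s t : 'S_N) (a : F).

Lemma rootGL_conj s i j a : i != j ->
  (rootGL G i j a * permGL s = permGL s * rootGL G (s i) (s j) a)%g.
Proof.
move=> nij; apply: mxP => k m; rewrite -[m](permKV s) mul_permGLE permGL_mulE.
rewrite !rootGLE ?(inj_eq perm_inj) // !mxE !(inj_eq perm_inj).
by [].
Qed.

Lemma rootGL_lower i j a : (j < i)%N -> rootGL G i j a \in L.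
Proof.
move=> lt_ji; apply/lower_unitriP=> k m le_km.
rewrite rootGLE; last by rewrite -val_eqE gtn_eqF.
rewrite !mxE; case: andP => [[/eqP ki /eqP mj]|_]; last by rewrite mulr0 addr0.
by move: lt_ji; rewrite -mj -ki ltnNge le_km.
Qed.

(** The cells are taken with respect to the lower unitriangular group on the
    right. Stability under a simple reflection comes from the rank one
    relation, applied to whichever of [s] and its reflected permutation makes
    the root element on the right lower triangular. *)
Lemma bruhat g : exists b s v, [/\ b \in B, v \in L & g = (b * permGL s * v)%g].
Proof.
have B1 := group1 (borel_group G); have L1 := group1 (lower_unitri_group G).
move: g; apply: GL_ind => [|b g Bb [b' [s [v [Bb' Lv ->]]]]|].
- by exists 1%g, 1%g, 1%g; split; rewrite ?permGL1 ?mulg1.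
- by exists (b * b')%g, s, v; rewrite groupM // !mulgA.
move=> i j _ ji [b [s [v [Bb Lv ->]]]]; set r := permGL (tperm i j).
have lt_ij : (i < j)%N by rewrite ji.
have nij : i != j by rewrite -val_eqE ltn_eqF.
have rr : (r * r = 1)%g by apply: permGL_tpermK.
have [b' [a [-> Bb' _]]] := borel_simple_split ji Bb.
set x := rootGL G i j a; set b1 := (_ * b' * _)%g in Bb'.
have -> : (r * (b' * x * permGL s * v) = b1 * (r * x * permGL s * v))%g.
  by rewrite /b1 -!mulgA (mulgA r r) rr mul1g.
suff [b2 [t [w [Bb2 Lw ->]]]] : exists b2 t w, [/\ b2 \in B, w \in L &
    (r * x * permGL s * v = b2 * permGL t * w)%g].
  by exists (b1 * b2)%g, t, w; rewrite groupM // !mulgA.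
have [lt_s|] := ltnP (s j) (s i).
  exists 1%g, (tperm i j * s)%g, (rootGL G (s i) (s j) a * v)%g.
  rewrite B1 groupM ?rootGL_lower // mul1g permGLM.
  by rewrite -/r /x -(mulgA r) rootGL_conj // !mulgA.
rewrite leq_eqVlt (inj_eq val_inj) (inj_eq perm_inj) (negPf nij) /= => lt_s.
have [a0|a0] := eqVneq a 0.
  exists 1%g, (tperm i j * s)%g, v; split=> //.
  by rewrite /x a0 rootGL0 mulg1 mul1g permGLM.
have [h dh rxr] := rank_one_relation G nij a0.
pose t := (tperm i j * s)%g.
have rs : (r * permGL t = permGL s)%g by rewrite /t permGLM mulgA rr mul1g.
exists (rootGL G i j a^-1 * h)%g, s, (rootGL G (t i) (t j) a^-1 * v)%g; split.
- exact: groupM (unitri_borel (rootGL_unitri G _ lt_ij)) (diagGL_borel dh).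
- by apply: groupM Lv; apply: rootGL_lower; rewrite !permM tpermL tpermR.
rewrite -{1}rs (mulgA _ r) rxr -!mulgA; congr (_ * (_ * _))%g.
by rewrite (mulgA (rootGL G i j a^-1)) rootGL_conj // -rs -!mulgA.
Qed.

End Bruhat.

Section PermutationLemmas.
Variable n : nat.
Local Notation N := n.+1.
Implicit Types (s t : 'S_N) (i j : 'I_N).

Lemma leq_sum_eq (f g : 'I_N -> nat) : (forall i, f i <= g i)%N ->
  (\sum_i f i = \sum_i g i)%N -> forall i, f i = g i.
Proof.
move=> le_fg eq_s i; apply/eqP; rewrite eqn_leq le_fg leqNgt /=.
apply: contra_eqN eq_s => lt_i; rewrite (bigD1 i) //= [X in _ != X](bigD1 i) //=.
by rewrite neq_ltn -addSn leq_add // leq_sum.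
Qed.

(** Both permutations have the same sum of values. *)
Lemma perm_leq_eq s t : (forall i, s i <= t i)%N -> s = t.
Proof.
move=> le_st; apply/permP=> i; apply: val_inj.
apply: (leq_sum_eq le_st).
have sum_perm (u : 'S_N) : (\sum_i u i = \sum_(i < N) i)%N.
  by rewrite [RHS](reindex_inj (@perm_inj _ u)).
by rewrite !sum_perm.
Qed.

Lemma increasing_perm1 s : (forall i j, i < j -> s i < s j)%N -> s = 1%g.
Proof.
move=> incr; apply/esym/perm_leq_eq => i; rewrite perm1.
case: i => m; elim: m => // m IHm lt_m.
have lt_m' : (m < N)%N by apply: ltnW.
by apply: leq_ltn_trans (IHm lt_m') _; apply: incr; rewrite /=.
Qed.

End PermutationLemmas.

(** One of the terms of the Leibniz formula is non-zero. *)
Lemma det_neq0_perm (F : fieldType) m (A : 'M[F]_m) :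
  \det A != 0 -> exists s : 'S_m, forall i, A i (s i) != 0.
Proof.
move=> nz; apply: contrapT => no_s; case/negP: nz; apply/eqP.
rewrite /determinant big1 // => s _.
suff [i Ai0] : exists i, A i (s i) = 0 by rewrite (bigD1 i) //= Ai0 mul0r mulr0.
apply: contrapT => no_i; apply: no_s; exists s => i.
by apply/eqP=> Ai0; apply: no_i; exists i.
Qed.

Section ParabolicIndex.
Variables (F : finFieldType) (n : nat) (G : linear_group F n).
Local Notation N := n.+1.
Local Notation U := (lg_unitri G).
Local Notation B := (lg_borel G).
Local Notation L := (lower_unitri G).
Local Notation permGL := (@permGL F n G).
Implicit Types (g h u v b : G) (i j k m : 'I_N) (s t : 'S_N) (a : F).

(** The simple roots of the parabolic subgroup, encoded by pairs [i, i.+1]. *)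
Variable J : rel 'I_N.

Definition parabolic_of : {set G} :=
  <<B :|: [set g : G | [exists i : 'I_N, exists j : 'I_N,
       [&& (j == i.+1 :> nat), J i j & g == permGL (tperm i j)]]]>>%g.
Local Notation P := parabolic_of.
Canonical parabolic_of_group := Eval hnf in [group of P].

Lemma borel_parabolic b : b \in B -> b \in P.
Proof. by move=> Bb; rewrite mem_gen // inE Bb. Qed.

Lemma refl_parabolic i j : j = i.+1 :> nat -> J i j -> permGL (tperm i j) \in P.
Proof.
move=> ji Jij; rewrite mem_gen // !inE; apply/orP; right.
by apply/existsP; exists i; apply/existsP; exists j; rewrite ji Jij !eqxx.
Qed.

(** [J] on natural numbers, so that blocks can be defined by recursion. *)
Definition linked (m : nat) :=
  [exists i : 'I_N, exists j : 'I_N, [&& i == m :> nat, j == m.+1 :> nat & J i j]].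

(** The diagonal block containing a row: the number of breaks before it. *)
Definition block (m : nat) := (\sum_(k < m) ~~ linked k)%N.

Lemma blockS (m : nat) : block m.+1 = (block m + ~~ linked m)%N.
Proof. exact: big_ord_recr. Qed.

Lemma block_leq (m m' : nat) : (m <= m')%N -> (block m <= block m')%N.
Proof.
move/subnK <-; elim: (m' - m)%N => [|d IHd]; first by rewrite add0n.
by rewrite addSn blockS (leq_trans IHd) ?leq_addr.
Qed.

Lemma linkedP i j : j = i.+1 :> nat -> J i j = linked i.
Proof.
move=> ji; apply/idP/existsP=> [Jij|[i' /existsP[j' /and3P[/eqP ii /eqP jj Jij]]]].
  by exists i; apply/existsP; exists j; rewrite ji !eqxx.
have -> : i = i' by apply/val_inj/esym.
by have -> : j = j' by apply: val_inj; rewrite [LHS]ji [RHS]jj.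
Qed.

Lemma block_succ i j : j = i.+1 :> nat -> J i j -> block j = block i.
Proof. by move=> ji Jij; rewrite ji blockS -(linkedP ji) Jij addn0. Qed.

(** An upper bound for [P] that can be read off from matrix entries. *)
Definition block_upper : {set G} :=
  [set g : G | [forall i : 'I_N, forall j : 'I_N,
     (block j < block i)%N ==> (mx g i j == 0)]].

Lemma block_upperP g :
  reflect (forall i j, (block j < block i)%N -> mx g i j = 0) (g \in block_upper).
Proof.
rewrite inE; apply: (iffP forallP) => [Pg i j lt_ji|Pg i].
  by have /forallP/(_ j)/implyP/(_ lt_ji)/eqP := Pg i.
by apply/forallP=> j; apply/implyP=> /Pg->.
Qed.

Fact block_upper_group_set : group_set block_upper.
Proof.
apply/group_setP; split=> [|g h /block_upperP Pg /block_upperP Ph].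
  apply/block_upperP=> i j lt_ji; rewrite mx1 mxE.
  by have [ij|//] := eqVneq i j; rewrite ij ltnn in lt_ji.
apply/block_upperP=> i j lt_ji; rewrite mxM mxE big1 // => k _.
have [lt_ki|le_ik] := ltnP (block k) (block i); first by rewrite Pg ?mul0r.
by rewrite Ph ?mulr0 // (leq_trans lt_ji).
Qed.
Canonical block_upper_group := Group block_upper_group_set.

Lemma parabolic_block_upper : P \subset block_upper.
Proof.
rewrite gen_subG; apply/subsetP=> g; rewrite inE => /orP[Bg|].
  apply/block_upperP=> i j lt_ji; apply: (borelP _ Bg).
  by rewrite ltnNge; apply: contraL lt_ji => /block_leq; rewrite -leqNgt.
rewrite inE => /existsP[i /existsP[j /and3P[/eqP ji Jij /eqP->]]].
apply/block_upperP=> k m lt_mk; rewrite permGLE !mxE.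
have [km|//] := eqVneq (tperm i j k) m; suff bk : block (tperm i j k) = block k.
  by rewrite km in bk; rewrite bk ltnn in lt_mk.
by case: tpermP => // ->; rewrite (block_succ ji Jij).
Qed.

(** The longest elements of the cosets of the Weyl group of [P]; they index the
    double cosets of [P] and [L]. *)
Definition descends s :=
  [forall i : 'I_N, forall j : 'I_N, (j == i.+1 :> nat) && J i j ==> (s j < s i)%N].

Lemma descendsP s :
  reflect (forall i j, j = i.+1 :> nat -> J i j -> (s j < s i)%N) (descends s).
Proof.
apply: (iffP forallP) => [Ds i j ji Jij|Ds i].
  by have /forallP/(_ j) := Ds i; rewrite ji eqxx Jij.
by apply/forallP=> j; apply/implyP=> /andP[/eqP]; apply: Ds.
Qed.

Lemma descends_block s i j : descends s -> (i < j)%N -> block i = block j ->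
  (s j < s i)%N.
Proof.
move=> Ds; have [d] := ubnP (j - i); elim: d j => // d IHd j; rewrite ltnS => le_d lt_ij bij.
have j0 : (0 < j)%N by apply: leq_trans lt_ij.
have lt_k : (j.-1 < N)%N by apply: leq_ltn_trans (leq_pred j) _.
pose k := Ordinal lt_k; have jk : j = k.+1 :> nat by rewrite /= prednK.
have le_ik : (i <= k)%N by rewrite -ltnS -jk.
have bk : block i = block k.
  apply/eqP; rewrite eqn_leq block_leq //= bij block_leq //.
  by rewrite jk.
have Jkj : J k j.
  move: bij; rewrite jk blockS bk -(linkedP jk); case: (J k j) => //.
  by move/eqP; rewrite addn1 eqn_leq ltnn andbF.
have lt_jk : (s j < s k)%N by apply: (descendsP _ Ds).
have [ik|] := eqVneq (i : nat) k; first by rewrite (val_inj ik).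
rewrite neq_ltn [(k < i)%N]ltnNge le_ik orbF => lt_ik.
apply: ltn_trans lt_jk (IHd k _ lt_ik bk).
by apply: leq_trans le_d; rewrite jk subSn.
Qed.

Definition dcoset s : {set G} := (P :* permGL s * L)%g.

Lemma dcosetP s g : reflect (exists p v, [/\ p \in P, v \in L & g = (p * permGL s * v)%g])
  (g \in dcoset s).
Proof.
apply: (iffP mulsgP) => [[x v /rcosetP[p Pp ->] Lv ->]|[p [v [Pp Lv ->]]]].
  by exists p, v.
by exists (p * permGL s)%g v => //; apply/rcosetP; exists p.
Qed.

(** A measure that drops when an ascent of [s] is turned into a descent. *)
Definition weight s := (\sum_(i < N) i * s i)%N.

Lemma weight_swap s i j : j = i.+1 :> nat -> (s i < s j)%N ->
  (weight (tperm i j * s) < weight s)%N.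
Proof.
move=> ji lt_s; have ji' : j != i by rewrite -val_eqE /= ji gtn_eqF.
rewrite /weight (bigD1 i) //= (bigD1 j) //= [X in (_ < X)%N](bigD1 i) //=.
rewrite [X in (_ < _ + X)%N](bigD1 j) //= !permM tpermL tpermR !addnA.
under eq_bigr => k /andP[ki kj] do rewrite permM tpermD 1?eq_sym //.
by rewrite ltn_add2r ji; nia.
Qed.

(** Among the representatives of a double coset, one of minimal weight descends
    along all simple roots of [P], since their reflections belong to [P]. *)
Lemma dcoset_exists g : exists2 s, descends s & g \in dcoset s.
Proof.
have [b [t [v [Bb Lv ->]]]] := bruhat g.
pose Q s := (permGL t * (permGL s)^-1)%g \in P.
have Qt : Q t by rewrite /Q mulgV group1.
case: (arg_minnP weight Qt) => s Qs min_s; exists s; last first.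
  apply/dcosetP; exists (b * (permGL t * (permGL s)^-1))%g, v; split=> //.
    by rewrite groupM // borel_parabolic.
  by rewrite !mulgA mulgKV.
apply/descendsP=> i j ji Jij; rewrite ltnNge leq_eqVlt; apply/negP=> /predU1P[].
  by move/val_inj/perm_inj=> ij; move: ji; rewrite ij => /n_Sn.
move=> lt_s; have := weight_swap ji lt_s; rewrite ltnNge min_s //.
rewrite /Q permGLM invMg permGL_tpermV mulgA groupM //.
exact: refl_parabolic.
Qed.

(** The element [h] of [P] with [h = t w s^-1] and [w] lower unitriangular has a
    transversal of non-zero entries, [r]. The shape of [w] forces [t = r * s], the
    shape of [h] forces [r] to preserve the blocks, and since both [s] and [t]
    decrease on the blocks, [r] is increasing. *)
Lemma dcoset_uniq s t g : descends s -> descends t ->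
  g \in dcoset s -> g \in dcoset t -> s = t.
Proof.
move=> Ds Dt /dcosetP[p [v [Pp Lv ->]]] /dcosetP[p' [v' [Pp' Lv' eq_g]]].
pose h := (p'^-1 * p)%g; pose w := (v' * v^-1)%g.
have Lw : w \in L by rewrite groupM ?groupV.
have hE : h = (permGL t * w * (permGL s)^-1)%g.
  apply: (mulgI p'); apply: (mulIg (permGL s)); apply: (mulIg v).
  by rewrite /h /w mulKVg eq_g !mulgA mulgKV mulgKV.
have Ph : h \in block_upper.
  by apply: (subsetP parabolic_block_upper); rewrite groupM ?groupV.
have [r hr] := det_neq0_perm (mx_det h).
have tE : t = (r * s)%g.
  apply/esym/perm_leq_eq => i; rewrite leqNgt; apply: contra (hr i) => lt_i.
  rewrite hE -permGLV -{1}[r i](permK s) mul_permGLE permGL_mulE.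
  rewrite (lower_unitriP _ Lw); last by rewrite -permM ltnW.
  by rewrite -permM -val_eqE ltn_eqF.
have br i : block (r i) = block i.
  apply/esym; move: i; apply: leq_sum_eq => [i|].
    by rewrite leqNgt; apply: contra (hr i) => lt_i; rewrite (block_upperP _ Ph).
  by rewrite [LHS](reindex_inj (@perm_inj _ r)).
suff r1 : r = 1%g by rewrite tE r1 mul1g.
apply: increasing_perm1 => i j lt_ij.
have nij : r i != r j by rewrite (inj_eq perm_inj) -val_eqE ltn_eqF.
have [eqb|] := eqVneq (block i) (block j); last first.
  move=> neb; have : (block (r i) < block (r j))%N.
    by rewrite !br ltn_neqAle neb block_leq // ltnW.
  by rewrite ltnNge; apply: contraR; rewrite -leqNgt; apply: block_leq.
rewrite ltn_neqAle nij leqNgt; apply/negP=> lt_r.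
have := descends_block Dt lt_ij eqb; rewrite tE !permM ltnNge ltnW //.
by apply: descends_block => //; rewrite !br.
Qed.

End ParabolicIndex.

Section PatternCount.
Variables (F : finFieldType) (n : nat) (G : linear_group F n).
Local Notation N := n.+1.
Local Notation U := (lg_unitri G).
Local Notation B := (lg_borel G).
Local Notation L := (lower_unitri G).
Local Notation permGL := (@permGL F n G).
Implicit Types (g h u v b : G) (i j k m : 'I_N) (s t : 'S_N) (a : F).
Implicit Type r : rel 'I_N.

Definition pattern r : {set G} :=
  [set g : G | [forall i : 'I_N, forall j : 'I_N,
     ~~ r i j ==> (mx g i j == (i == j)%:R)]].

Lemma patternP r g :
  reflect (forall i j, ~~ r i j -> mx g i j = (i == j)%:R) (g \in pattern r).
Proof.
rewrite inE; apply: (iffP forallP) => [Pg i j nr|Pg i].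
  by have /forallP/(_ j)/implyP/(_ nr)/eqP := Pg i.
by apply/forallP=> j; apply/implyP=> /Pg->.
Qed.

Definition positions r := [set ij : 'I_N * 'I_N | r ij.1 ij.2].

Lemma card_pattern r :
    (forall A : 'M[F]_N, (forall i j, ~~ r i j -> A i j = (i == j)%:R) ->
       A \in unitmx) ->
  #|pattern r| = (#|F| ^ #|positions r|)%N.
Proof.
move=> unit_r.
pose A (f : {ffun 'I_N * 'I_N -> F}) : 'M[F]_N :=
  \matrix_(i, j) ((i == j)%:R + f (i, j)).
pose D := pffun_on 0 (mem (positions r)) (mem F).
have fD f i j : f \in D -> ~~ r i j -> f (i, j) = 0.
  move=> /pffun_onP[/supportP Df _] nr; apply: Df.
  by rewrite inE.
have uA f : f \in D -> A f \in unitmx.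
  by move=> Df; apply: unit_r => i j nr; rewrite mxE (fD f) ?addr0.
rewrite -(card_pffun_on (0 : F) (mem (positions r)) (mem F)) -/D.
have -> : pattern r = [set toGL G (A f) | f in D].
  apply/setP=> g; apply/patternP/imsetP=> [gr|[f Df ->] i j nr]; last first.
    by rewrite toGLK ?uA // mxE (fD f) ?addr0.
  pose f : {ffun 'I_N * 'I_N -> F} := [ffun ij => mx g ij.1 ij.2 - (ij.1 == ij.2)%:R].
  have Df : f \in D.
    apply/pffun_onP; split=> [|x _]; last by rewrite inE.
    apply/supportP=> -[i j]; rewrite inE /= => nr.
    by rewrite ffunE gr // subrr.
  exists f => //; apply: mx_inj; rewrite toGLK ?uA //.
  by apply/matrixP=> i j; rewrite mxE ffunE addrC subrK.
apply: card_in_imset => f f' Df Df' /(congr1 mx); rewrite !toGLK ?uA // => ff'.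
apply/ffunP=> -[i j]; have /(congr1 (fun M : 'M_N => M i j)) := ff'.
by rewrite !mxE => /addrI.
Qed.

Lemma card_upper_pattern r : (forall i j, r i j -> (i < j)%N) ->
  #|pattern r| = (#|F| ^ #|positions r|)%N.
Proof.
move=> ltr; apply: card_pattern => A Ar; rewrite unitmxE -det_tr det_trig.
  rewrite big1 ?unitr1 // => i _; rewrite mxE Ar ?eqxx //.
  by apply/negP=> /ltr; rewrite ltnn.
apply/is_trig_mxP=> i j lt_ij; rewrite mxE Ar -?val_eqE ?gtn_eqF //.
by apply/negP=> /ltr; rewrite ltnNge ltnW.
Qed.

Lemma card_lower_pattern r : (forall i j, r i j -> (j < i)%N) ->
  #|pattern r| = (#|F| ^ #|positions r|)%N.
Proof.
move=> ltr; apply: card_pattern => A Ar; rewrite unitmxE det_trig.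
  rewrite big1 ?unitr1 // => i _; rewrite Ar ?eqxx //.
  by apply/negP=> /ltr; rewrite ltnn.
apply/is_trig_mxP=> i j lt_ij; rewrite Ar -?val_eqE ?ltn_eqF //.
by apply/negP=> /ltr; rewrite ltnNge ltnW.
Qed.

(** The groups [U :&: s U s^-1] and [U :&: s L s^-1]. *)
Definition unitri_cap s := pattern (fun i j => (i < j)%N && (s i < s j)%N).
Definition unitri_inv s := pattern (fun i j => (i < j)%N && (s j < s i)%N).

Lemma lower_unitri_pattern : L = pattern (fun i j => (j < i)%N).
Proof.
apply/setP=> g; apply/lower_unitriP/patternP=> Lg i j; have := Lg i j.
  by rewrite -leqNgt.
by rewrite -leqNgt.
Qed.

Lemma card_unitri_cap_inv s : (#|unitri_cap s| * #|unitri_inv s| = #|L|)%N.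
Proof.
rewrite lower_unitri_pattern card_lower_pattern //.
rewrite !card_upper_pattern => [|i j /andP[]|i j /andP[]] //.
rewrite -expnD; congr (_ ^ _)%N.
have swap_inj : injective (fun ij : 'I_N * 'I_N => (ij.2, ij.1)).
  by move=> [i j] [i' j'] [-> ->].
rewrite -[RHS](card_imset _ swap_inj).
set X := positions _; set Y := positions _; set Z := imset _ _.
have dXY : [disjoint X & Y].
  rewrite -setI_eq0; apply/eqP/setP=> -[i j]; rewrite !inE /=.
  by case: (i < j)%N => //=; case: ltngtP.
rewrite -(leq_card_setU X Y).2 in dXY.
rewrite -(eqP dXY); congr #|pred_of_set _|.
apply/setP=> -[i j]; rewrite !inE /=; apply/idP/imsetP=> [lt|[[i' j']]].
  exists (j, i) => //; rewrite inE /=.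
  by case/orP: lt => /andP[].
rewrite inE /= => lt [-> ->]; rewrite lt /= -neq_ltn.
by rewrite val_eqE (inj_eq perm_inj) -val_eqE neq_ltn lt.
Qed.

Variable J : rel 'I_N.
Local Notation P := (parabolic_of G J).

(** For [v] in [L] and [j < i], the entry [i, j] of [s v s^-1] can only be non-zero
    if [s j < s i]. Inside a block this is excluded, since [s] decreases there,
    and below the blocks [P] has no entries. *)
Lemma parabolic_cap_lower s : descends J s ->
  (P :&: L :^ (permGL s)^-1 = unitri_inv s)%g.
Proof.
move=> Ds; apply/setP=> g; rewrite inE mem_conjg invgK.
have gE i j : mx (g ^ permGL s)%g (s i) (s j) = mx g i j.
  by rewrite conjgE mulgA permGL_conjVE.
apply/andP/patternP=> [[Pg /lower_unitriP Lg] i j|gr].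
  rewrite negb_and -!leqNgt -gE => /orP[le_ji|le_s]; last first.
    by rewrite Lg // (inj_eq perm_inj).
  have [le_s|lt_s] := leqP (s i) (s j); first by rewrite Lg // (inj_eq perm_inj).
  move: le_ji; rewrite leq_eqVlt => /predU1P[/val_inj ji|lt_ji].
    by rewrite ji ltnn in lt_s.
  rewrite gE -val_eqE gtn_eqF //.
  apply: (block_upperP J g _); first exact: (subsetP (parabolic_block_upper G J)).
  rewrite ltn_neqAle block_leq ?(ltnW lt_ji) // andbT; apply/eqP=> bji.
  by have := descends_block Ds lt_ji bji; rewrite ltnNge ltnW.
split.
  apply/borel_parabolic/unitri_borel/unitriP=> i j le_ji; apply: gr.
  by rewrite negb_and -leqNgt le_ji.
apply/lower_unitriP=> i j; rewrite -[i](permKV s) -[j](permKV s) gE => le_s.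
set i' := _ i in le_s *; set j' := _ j in le_s *.
rewrite gr ?[s i' == _](inj_eq perm_inj) //.
by rewrite negb_and -!leqNgt le_s orbT.
Qed.

Lemma card_dcoset s : descends J s -> #|dcoset G J s| = (#|P| * #|unitri_cap s|)%N.
Proof.
move=> Ds; have inv_gt0 : (0 < #|unitri_inv s|)%N.
  by rewrite -(parabolic_cap_lower Ds) cardG_gt0.
apply/eqP; rewrite -(eqn_pmul2r inv_gt0) -mulnA card_unitri_cap_inv; apply/eqP.
have := mul_cardG (parabolic_of_group G J) (lower_unitri_group G :^ (permGL s)^-1)%G.
rewrite /= cardJg (parabolic_cap_lower Ds) => ->; congr (_ * _)%N.
rewrite -[RHS](card_rcoset _ (permGL s)); congr #|pred_of_set _|.
by rewrite /dcoset conjsgE invgK -!mulgA mulg_set1 mulVg mulg1.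
Qed.

(** The double cosets of [P] and [L] partition the group, and the one of [s] is a
    union of [#|unitri_cap s|] right cosets of [P]. *)
Theorem parabolic_index :
  #|[set: G] : P|%g = (\sum_(s | descends J s) #|unitri_cap s|)%N.
Proof.
have P_gt0 : (0 < #|P|)%N := cardG_gt0 (parabolic_of_group G J).
apply/eqP; rewrite -(eqn_pmul2l P_gt0) (@Lagrange _ [group of [set: G]] (parabolic_of_group G J)).
  rewrite big_distrr /=.
  under eq_bigr => s Ds do rewrite -card_dcoset // -sum1_card big_mkcond /=.
  rewrite exchange_big /= -sum1_card; apply/eqP.
  apply: eq_big => [g|g _]; first by rewrite inE.
  have [s Ds gs] := dcoset_exists J g.
  rewrite (bigD1 s) //= gs big1 ?addn0 // => t /andP[Dt ts].
  by case: ifP => // gt; case/eqP: ts; apply: dcoset_uniq gt gs.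
exact: subsetT.
Qed.

End PatternCount.

(** * The invariant form *)

Section Form.
Variables (R : comNzRingType) (gT : finGroupType).
Local Notation A := (galg R gT).
Implicit Types (x y z : A) (r : R) (g h : gT).

(** The form without the factor [1 / #|B|], to stay inside [R]. *)
Definition dot x y : R := \sum_g x g * y g.

Lemma dotC x y : dot x y = dot y x.
Proof. by apply: eq_bigr => g _; rewrite mulrC. Qed.

Lemma dotDl x y z : dot (x + y) z = dot x z + dot y z.
Proof. by rewrite -big_split; apply: eq_bigr => g _; rewrite galgD mulrDl. Qed.

Lemma dotZl r x z : dot (r *: x) z = r * dot x z.
Proof. by rewrite mulr_sumr; apply: eq_bigr => g _; rewrite galgZ mulrA. Qed.

Lemma dot_suml (I : Type) (e : seq I) (Q : pred I) (f : I -> A) z :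
  dot (\sum_(c <- e | Q c) f c) z = \sum_(c <- e | Q c) dot (f c) z.
Proof.
apply: (big_morph (dot^~ z)) => [x y|]; first exact: dotDl.
by rewrite /dot big1 // => g _; rewrite galg0 mul0r.
Qed.

Lemma dotZr r x z : dot z (r *: x) = r * dot z x.
Proof. by rewrite dotC dotZl dotC. Qed.

Lemma dot_sumr (I : Type) (e : seq I) (Q : pred I) (f : I -> A) z :
  dot z (\sum_(c <- e | Q c) f c) = \sum_(c <- e | Q c) dot z (f c).
Proof. by rewrite dotC dot_suml; apply: eq_bigr => c _; apply: dotC. Qed.

Lemma dot_gelt g x y : dot (gelt g * x) y = dot x (gelt g^-1%g * y).
Proof.
rewrite /dot (reindex_inj (mulgI g)); apply: eq_bigr => h _.
by rewrite !gelt_mulE mulKg invgK.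
Qed.

End Form.

Section SteinbergForm.
Variables (F : finFieldType) (n : nat) (G : linear_group F n) (R : idomainType).
Local Notation N := n.+1.
Local Notation U := (lg_unitri G).
Local Notation B := (lg_borel G).
Local Notation A := (galg R G).
Local Notation permGL := (@permGL F n G).
Local Notation eps := (@st_eps F n G R).
Local Notation bhat := (@bhat F n G R).
Implicit Types (g h u v b : G) (i j k m : 'I_N) (s t : 'S_N) (a : F).
Implicit Types (x y z : A) (r : R).

Lemma gelt_bhatE g h : galg_coef (gelt g * bhat) h = (g^-1 * h \in B)%g%:R.
Proof. by rewrite gelt_mulE hatE. Qed.

Lemma dot_bhat g h :
  dot (gelt g * bhat) (gelt h * bhat) = #|B|%:R * (g^-1 * h \in B)%g%:R.
Proof.
rewrite dot_gelt geltMA /dot.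
have B_gp := borel_group G.
rewrite (bigID (mem B)) /= [X in _ + X]big1 ?addr0; last first.
  by move=> k /negPf nBk; rewrite hatE nBk mul0r.
under eq_bigr => k Bk.
  rewrite hatE Bk mul1r gelt_bhatE.
  have -> : ((g^-1 * h)^-1 * k \in B)%g = (g^-1 * h \in B)%g.
    by rewrite (groupMr _ (x := k) (G := borel_group G)) // groupV.
  over.
by rewrite sumr_const mulr_natl.
Qed.

Lemma unitri_capE s : unitri_cap G s = U :&: (B :^ (permGL s)^-1)%g.
Proof.
apply/setP=> u; rewrite in_setI mem_conjg invgK.
have uE i j : mx (u ^ permGL s)%g (s i) (s j) = mx u i j.
  by rewrite conjgE mulgA permGL_conjVE.
apply/patternP/andP=> [ur|[Uu /borelP Bu] i j].
  split; first by apply/unitriP=> i j le_ji; apply: ur; rewrite negb_and -leqNgt le_ji.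
  apply/borelP=> i j; rewrite -[i](permKV s) -[j](permKV s) uE.
  set i' := _ i; set j' := _ j => lt_s.
  rewrite ur; last by rewrite negb_and -!leqNgt [(s j' <= _)%N]ltnW ?orbT.
  by have [ij|//] := eqVneq; rewrite ij ltnn in lt_s.
rewrite negb_and -!leqNgt => /orP[le_ji|]; first by rewrite (unitriP _ Uu).
rewrite leq_eqVlt (inj_eq val_inj) (inj_eq perm_inj) => /predU1P[->|lt_s].
  by rewrite (unitriP _ Uu).
by rewrite -uE Bu //; have [ij|//] := eqVneq; rewrite ij ltnn in lt_s.
Qed.

Fact unitri_cap_group_set s : group_set (unitri_cap G s).
Proof.
rewrite unitri_capE.
exact: (groupP (unitri_group G :&: borel_group G :^ (permGL s)^-1)%G).
Qed.
Canonical unitri_cap_group s := Group (unitri_cap_group_set s).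

Lemma unitri_cap_unitri s u : u \in unitri_cap G s -> u \in U.
Proof. by rewrite unitri_capE in_setI => /andP[]. Qed.

(** If [u s B] meets [t B], an upper triangular matrix has a non-zero entry at each
    position [s i, t i], so that [s i <= t i] for all [i]. *)
Lemma bruhat_meet s t u : u \in U ->
  ((u * permGL s)^-1 * permGL t \in B)%g = (s == t) && (u \in unitri_cap G s).
Proof.
move=> Uu; have Uu' : (u^-1)%g \in U by rewrite groupV.
have [->|nst] /= := eqVneq s t.
  rewrite unitri_capE in_setI Uu /= mem_conjg invgK -[RHS](@groupV _ (borel_group G)).
  by rewrite conjgE !invMg invgK.
apply: contraNF nst => /borelP Bst; apply/eqP; apply: perm_leq_eq => i.
rewrite leqNgt; apply/negP=> /Bst; rewrite invMg -mulgA -permGLV.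
rewrite permGL_mulE permK mul_permGLE (unitriP _ Uu') // eqxx => /eqP.
by rewrite oner_eq0.
Qed.

Lemma dot_gelt_eps u : u \in U ->
  dot (gelt u * eps) eps = \sum_s #|B|%:R * (u \in unitri_cap G s)%:R.
Proof.
move=> Uu; rewrite /st_eps mulr_sumr dot_suml; apply: eq_bigr => s _.
rewrite dot_sumr (bigD1 s) //= galgMZr geltMA dotZl dotZr dot_bhat bruhat_meet //.
rewrite eqxx mulrA -signr_addb addbb mul1r big1 ?addr0 // => t nts.
by rewrite dotZl dotZr dot_bhat bruhat_meet // eq_sym (negPf nts) !mulr0.
Qed.

(** [stE lam] is the element [E_lam]; it is an eigenvector of [U] with character
    [1 / lam]. *)
Definition proj (lam : G -> R) : A := \sum_(u in U) lam u *: gelt u.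
Definition stE (lam : G -> R) : A := proj lam * eps.

Definition nontrivial_root (lam : G -> R) : rel 'I_N :=
  fun i j => [exists a, lam (rootGL G i j a) != 1].

Definition conj_char (lam : G -> R) : G -> R := fun u => (lam u)^-1.

Section Character.
Variable lam : G -> R.
Hypothesis lamU : linear_character lam.
Local Notation J := (nontrivial_root lam).

Lemma conj_charP : linear_character (conj_char lam).
Proof.
split=> [u Uu|u v Uu Uv]; rewrite /conj_char ?unitrV ?(character_unit lamU) //.
by rewrite (characterM lamU) // invrM ?(character_unit lamU) // mulrC.
Qed.

(** Orthogonality of characters on [U :&: s U s^-1]: [lam] is trivial there if and
    only if no simple root subgroup with [lam] non-trivial is contained in it. *)
Lemma sum_character_cap s :
  \sum_(u in unitri_cap G s) lam u = (descends J s)%:R * #|unitri_cap G s|%:R.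
Proof.
have capU := @unitri_cap_unitri s.
have [Ds|nDs] := boolP (descends J s).
  rewrite mul1r -sumr_const; apply: eq_bigr => u cu.
  apply: (character_support lamU) => [|i j lt_ij uij]; first exact: capU.
  have [le_ji|] := leqP j i.+1; last exact: character_nonsimple_root.
  have ji : j = i.+1 :> nat by apply/eqP; rewrite eqn_leq le_ji.
  apply/eqP; apply: contraTT cu => lam_ij.
  apply/negP=> /patternP/(_ i j) cu; case/negP: uij; rewrite cu.
    by rewrite -val_eqE ltn_eqF.
  rewrite negb_and -!leqNgt [(s j <= _)%N]ltnW ?orbT //; apply: (descendsP _ _ Ds) => //.
  by apply/existsP; exists (mx u i j).
rewrite mul0r; move: nDs; rewrite negb_forall => /existsP[i].
rewrite negb_forall => /existsP[j]; rewrite negb_imply -leqNgt.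
case/andP=> /andP[/eqP ji /existsP[a lam_a]] le_s.
have lt_ij : (i < j)%N by rewrite ji.
have nij : i != j by rewrite -val_eqE ltn_eqF.
set x := rootGL G i j a in lam_a.
have cx : x \in unitri_cap G s.
  apply/patternP=> k m nr; rewrite /x rootGLE // !mxE.
  case: andP => [[/eqP ki /eqP mj]|_]; last by rewrite mulr0 addr0.
  move: nr; rewrite ki mj lt_ij /= ltn_neqAle le_s.
  by rewrite (inj_eq val_inj) (inj_eq perm_inj) nij.
set S := \sum_(u in _) _; have : S = lam x * S.
  rewrite {1}/S (reindex_inj (mulgI x)) mulr_sumr /=.
  apply: eq_big => [u|u]; first by rewrite groupMl.
  by rewrite groupMl // => cu; rewrite (characterM lamU) ?capU.
move/eqP; rewrite -subr_eq0 -{1}[S]mul1r -mulrBl mulf_eq0 subr_eq0.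
by rewrite eq_sym (negPf lam_a) => /eqP.
Qed.

(** The surviving permutations are those indexing the double cosets of the
    parabolic subgroup, with the same weights. *)
Lemma dot_stE_eps :
  dot (stE lam) eps = #|B|%:R * #|[set: G] : parabolic_of G J|%g%:R.
Proof.
rewrite /stE /proj mulr_suml dot_suml.
under eq_bigr => u Uu.
  rewrite galgMZl dotZl dot_gelt_eps // mulr_sumr.
  over.
rewrite exchange_big /= parabolic_index natr_sum mulr_sumr [RHS]big_mkcond /=.
apply: eq_bigr => s _.
rewrite -[RHS]/(if descends J s then _ else _).
have -> : (if descends J s then #|B|%:R * #|unitri_cap G s|%:R else 0) =
          #|B|%:R * \sum_(u in unitri_cap G s) lam u :> R.
  by rewrite sum_character_cap; case: ifP; rewrite ?mul1r // mul0r mulr0.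
rewrite mulr_sumr (bigID (mem (unitri_cap G s))) /= [X in _ + X]big1 ?addr0.
  apply: eq_big => [u|u /andP[_ cu]]; last by rewrite cu mulr1 mulrC.
  by rewrite andbC; case: (boolP (u \in unitri_cap G s)) => // /unitri_cap_unitri.
by move=> u /andP[_ /negPf->]; rewrite !mulr0.
Qed.

Lemma gelt_proj u : u \in U -> gelt u * proj lam = (lam u)^-1 *: proj lam.
Proof.
move=> Uu; rewrite /proj mulr_sumr scaler_sumr (reindex_inj (mulgI u^-1%g)) /=.
apply: eq_big => [v|v]; first by rewrite groupMl ?groupV.
rewrite groupMl ?groupV // => Uv; rewrite galgMZr geltM mulKVg scalerA.
by rewrite (characterM lamU) ?groupV // (characterV lamU).
Qed.

Lemma proj_gelt u : u \in U -> proj lam * gelt u = (lam u)^-1 *: proj lam.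
Proof.
move=> Uu; rewrite /proj mulr_suml scaler_sumr (reindex_inj (mulIg u^-1%g)) /=.
apply: eq_big => [v|v]; first by rewrite groupMr ?groupV.
rewrite groupMr ?groupV // => Uv; rewrite galgMZl geltM mulgKV scalerA.
by rewrite (characterM lamU) ?groupV // (characterV lamU) // mulrC.
Qed.

Lemma gelt_stE u : u \in U -> gelt u * stE lam = (lam u)^-1 *: stE lam.
Proof. by move=> Uu; rewrite mulrA gelt_proj // galgMZl. Qed.

(** The elements [u eps] span, and all of them are projected to multiples of the
    same vector. *)
Lemma proj_ideal x : st_ideal x -> exists r, proj lam * x = r *: stE lam.
Proof.
move=> /steinberg_span[r ->]; exists (\sum_(u in U) r u * (lam u)^-1).
rewrite mulr_sumr scaler_suml; apply: eq_bigr => u Uu.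
by rewrite galgMZr mulrA proj_gelt // galgMZl scalerA.
Qed.

Lemma proj_stE : proj lam * stE lam = #|U|%:R *: stE lam.
Proof.
rewrite {1}/proj mulr_suml -sumr_const scaler_suml; apply: eq_bigr => u Uu.
by rewrite galgMZl gelt_stE // scalerA divrr ?(character_unit lamU).
Qed.

Lemma proj_eigen x : (forall u, u \in U -> gelt u * x = (lam u)^-1 *: x) ->
  proj lam * x = #|U|%:R *: x.
Proof.
move=> ux; rewrite {1}/proj mulr_suml -sumr_const scaler_suml.
apply: eq_bigr => u Uu.
by rewrite galgMZl ux // scalerA divrr ?(character_unit lamU).
Qed.

Lemma alternating_stE : gelt (alternating G) * stE lam = stE (conj_char lam).
Proof.
set t := alternating G; have tt : (t * t = 1)%g := alternatingK G.
rewrite /stE -{2}(torus_eps R (alternating_diag G)) !mulrA; congr (_ * _).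
have conjK : involutive (fun u => t * u * t)%g.
  by move=> u; rewrite !mulgA tt mul1g -mulgA tt mulg1.
rewrite /proj mulr_sumr mulr_suml (reindex_inj (inv_inj conjK)) /=.
apply: eq_big => [u|u tut].
  by apply/idP/idP=> /alternating_conj_unitri //; rewrite conjK.
have Uu : u \in U by rewrite -[u]conjK alternating_conj_unitri.
rewrite galgMZr galgMZl !geltM -/t !mulgA tt mul1g; congr (_ *: _).
have ulam := character_unit lamU Uu.
by apply: (mulIr ulam); rewrite (character_alternating lamU) // mulVr.
Qed.

Lemma dot_proj x : dot (proj (conj_char lam) * x) (stE lam) =
  #|U|%:R * dot x (stE lam).
Proof.
rewrite {1}/proj mulr_suml dot_suml mulr_natl -sumr_const.
apply: eq_bigr => u Uu; rewrite galgMZl dotZl dot_gelt gelt_stE ?groupV //.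
rewrite dotZr (characterV lamU) // invrK mulrA /conj_char mulVr ?mul1r //.
exact: (character_unit lamU).
Qed.

Lemma dot_stE_conj : dot (stE (conj_char lam)) (stE lam) =
  #|U|%:R * (#|B|%:R * #|[set: G] : parabolic_of G J|%g%:R).
Proof. by rewrite {1}/stE dot_proj dotC dot_stE_eps. Qed.

End Character.
End SteinbergForm.

(** * Eigenvectors of the unitriangular group *)

Section Orthogonality.
Variables (F : finFieldType) (R : idomainType) (psi : F -> R) (m : nat).
Hypotheses (psi0 : psi 0 = 1) (psiD : forall a b, psi (a + b) = psi a * psi b).
Hypothesis psi_nontrivial : exists a, psi a != 1.

(** For [x != 0], translating [b] multiplies the sum by a value of [psi] other
    than 1. *)
Lemma additive_character_sum (x : 'cV[F]_m) :
  \sum_(b : 'rV[F]_m) psi ((b *m x) 0 0) = ((x == 0) * #|F| ^ m)%:R.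
Proof.
have [->|x0] := eqVneq x 0.
  rewrite mul1n (eq_bigr (fun=> 1)) => [|b _]; last by rewrite mulmx0 mxE psi0.
  by rewrite sumr_const card_mx mul1n.
rewrite mul0n.
have [i xi] : exists i, x i 0 != 0.
  apply: contrapT => no_i; case/eqP: x0; apply/matrixP=> i j.
  rewrite (ord1 j) mxE; apply/eqP/negPn/negP=> xi0; apply: no_i; by exists i.
have [a psi_a] := psi_nontrivial.
pose b0 : 'rV[F]_m := (a / x i 0) *: delta_mx 0 i.
have b0x : (b0 *m x) 0 0 = a.
  by rewrite /b0 -scalemxAl mxE -rowE mxE divfK.
set S := \sum_(b : 'rV_m) _; have : S = psi a * S.
  rewrite {1}/S (reindex_inj (addrI b0)) mulr_sumr /=.
  by apply: eq_bigr => b _; rewrite mulmxDl mxE psiD b0x.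
move/eqP; rewrite -subr_eq0 -{1}[S]mul1r -mulrBl mulf_eq0 subr_eq0.
by rewrite eq_sym (negPf psi_a) => /eqP.
Qed.

End Orthogonality.

(** The Sherman-Morrison formula. *)
Lemma rank_one_update_unit (F : fieldType) m (c : 'cV[F]_m) (r : 'rV[F]_m) :
  1 + (r *m c) 0 0 != 0 -> 1%:M + c *m r \in unitmx.
Proof.
set d := 1 + _ => d0.
suff /mulmx1_unit[] : (1%:M + c *m r) *m (1%:M - d^-1 *: (c *m r)) = 1%:M by [].
have crcr : (c *m r) *m (c *m r) = (d - 1) *: (c *m r).
  rewrite mulmxA -(mulmxA c) [r *m c]mx11_scalar mul_mx_scalar -scalemxAl.
  by rewrite /d addrC addKr.
rewrite mulmxDl mul1mx mulmxBr mulmx1 -scalemxAr crcr scalerA.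
rewrite mulrBr mulVf // mulr1 scalerBl scale1r opprB [_ + (_ - _)]addrC subrK.
by rewrite -addrA addNr addr0.
Qed.

Section Column.
Variables (F : finFieldType) (n : nat) (G : linear_group F n).
Local Notation N := n.+1.
Local Notation U := (lg_unitri G).
Implicit Types (g h u v : G) (i j : 'I_N) (a : F) (x y : 'cV[F]_N).
Variable k : 'I_N.
Local Notation ek := (delta_mx 0 k : 'rV[F]_N).

Definition low x := [forall i : 'I_N, (k <= i)%N ==> (x i 0 == 0)].

Lemma lowP x : reflect (forall i, (k <= i)%N -> x i 0 = 0) (low x).
Proof.
apply: (iffP forallP) => [lx i le_ki|lx i].
  by have /implyP/(_ le_ki)/eqP := lx i.
by apply/implyP=> /lx->.
Qed.

Lemma low0 : low 0. Proof. by apply/lowP=> i _; rewrite mxE. Qed.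

Lemma lowD x y : low x -> low y -> low (x + y).
Proof. by move=> /lowP lx /lowP ly; apply/lowP=> i le; rewrite mxE lx // ly // addr0. Qed.

Lemma lowN x : low x -> low (- x).
Proof. by move=> /lowP lx; apply/lowP=> i le; rewrite mxE lx // oppr0. Qed.

Definition colGL x : G := toGL G (1%:M + x *m ek).

Lemma colGLE x : low x -> mx (colGL x) = 1%:M + x *m ek.
Proof.
move=> /lowP lx; rewrite toGLK // rank_one_update_unit //.
by rewrite -rowE mxE lx // addr0 oner_eq0.
Qed.

Lemma colGL_entry x i j : low x ->
  mx (colGL x) i j = (i == j)%:R + x i 0 * (j == k)%:R.
Proof.
by move=> lx; rewrite colGLE // !mxE big_ord1 !mxE.
Qed.

Lemma colGL_unitri x : low x -> colGL x \in U.
Proof.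
move=> lx; apply/unitriP=> i j le_ji; rewrite colGL_entry //.
have [jk|] := eqVneq j k; last by rewrite mulr0 addr0.
by rewrite (lowP _ lx) ?mul0r ?addr0 // -jk.
Qed.

Lemma colGLD x y : low x -> low y -> colGL (x + y) = (colGL x * colGL y)%g.
Proof.
move=> lx ly; apply: mx_inj; rewrite mxM !colGLE ?lowD //.
rewrite mulmxDl !mulmxDr !mul1mx mulmx1 -mulmxA (mulmxA ek) -rowE.
rewrite [row k y](_ : _ = 0); last first.
  by apply/rowP=> i; rewrite !mxE (ord1 i) (lowP _ ly).
by rewrite mul0mx mulmx0 addr0 mulmxDl addrA addrAC.
Qed.

Lemma colGL0 : colGL 0 = 1%g.
Proof. by apply: mx_inj; rewrite colGLE ?low0 // mul0mx addr0 mx1. Qed.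

(** Matrices with trivial rows from [k] on. They normalize the group of column [k]
    and act on it linearly; they also act on the unitriangular matrices with
    trivial columns up to [k] without changing the superdiagonal. *)
Definition fixrows g := [forall i : 'I_N, (k <= i)%N ==> (row i (mx g) == row i 1%:M)].

Lemma fixrowsP g :
  reflect (forall i j, (k <= i)%N -> mx g i j = (i == j)%:R) (fixrows g).
Proof.
apply: (iffP forallP) => [fg i j le_ki|fg i].
  have /implyP/(_ le_ki)/eqP/rowP/(_ j) := fg i.
  by rewrite !mxE.
by apply/implyP=> le_ki; apply/eqP/rowP=> j; rewrite !mxE fg.
Qed.

Lemma fixrows_mul g x i : fixrows g -> (k <= i)%N -> (mx g *m x) i 0 = x i 0.
Proof.
move=> /fixrowsP fg le_ki; rewrite mxE (bigD1 i) //= fg // eqxx mul1r.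
by rewrite big1 ?addr0 // => j ji; rewrite fg // eq_sym (negPf ji) mul0r.
Qed.

Lemma fixrowsV g : fixrows g -> fixrows g^-1%g.
Proof.
move=> fg; apply/forallP=> i; apply/implyP=> le_ki; apply/eqP.
have gg : mx g *m mx g^-1 = 1%:M by rewrite -mxM mulgV mx1.
have /forallP/(_ i)/implyP/(_ le_ki)/eqP gi := fg.
by rewrite -[in RHS]gg row_mul gi -row_mul mul1mx.
Qed.

Lemma fixrows_colGL x : low x -> fixrows (colGL x).
Proof.
move=> lx; apply/fixrowsP=> i j le_ki.
by rewrite colGL_entry // (lowP _ lx) // mul0r addr0.
Qed.

Lemma low_fixrows g x : fixrows g -> low x -> low (mx g *m x).
Proof. by move=> fg /lowP lx; apply/lowP=> i le_ki; rewrite fixrows_mul ?lx. Qed.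

Lemma colGL_conj g x : fixrows g -> low x ->
  (colGL x * g = g * colGL (mx g^-1 *m x))%g.
Proof.
move=> fg lx; apply: mx_inj; rewrite !mxM !colGLE ?low_fixrows ?fixrowsV //.
rewrite mulmxDl mulmxDr mul1mx mulmx1; congr (_ + _).
rewrite -mulmxA -rowE; have /forallP/(_ k)/implyP/(_ (leqnn k))/eqP-> := fg.
by rewrite row1 !mulmxA -mxM mulgV mx1 mul1mx.
Qed.

Definition coltriv (d : nat) u :=
  [forall i : 'I_N, forall j : 'I_N, (j < d)%N ==> (mx u i j == (i == j)%:R)].

Lemma coltrivP d u :
  reflect (forall i j, (j < d)%N -> mx u i j = (i == j)%:R) (coltriv d u).
Proof.
apply: (iffP forallP) => [tu i j lt|tu i].
  by have /forallP/(_ j)/implyP/(_ lt)/eqP := tu i.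
by apply/forallP=> j; apply/implyP=> /tu->.
Qed.

(** Since [u - 1] has its non-zero columns after [k], where the rows of [g] are
    trivial, multiplication by [g] on the right does not affect it. *)
Lemma conj_coltriv g u : fixrows g -> coltriv k.+1 u ->
  mx (g^-1 * u * g)%g = 1%:M + mx g^-1 *m (mx u - 1%:M).
Proof.
move=> /fixrowsP fg /coltrivP tu.
have Mg : (mx u - 1%:M) *m mx g = mx u - 1%:M.
  apply/matrixP=> i j; rewrite mxE.
  rewrite (eq_bigr (fun m => (mx u - 1%:M) i m * (m == j)%:R)) => [|m _]; last first.
    have [le_mk|lt_km] := leqP m k; last by rewrite fg // ltnW.
    by rewrite !mxE tu // subrr !mul0r.
  rewrite (bigD1 j) //= eqxx mulr1 big1 ?addr0 // => m /negPf->.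
  by rewrite mulr0.
rewrite !mxM -[mx u](subrK 1%:M) mulmxDr mulmxDl mulmx1 -mulmxA Mg addrC.
by rewrite -mxM mulVg mx1 addrK.
Qed.

Section ConjColtriv.
Variables (g u : G).
Hypotheses (fg : fixrows g) (Uu : u \in U) (tu : coltriv k.+1 u).

Lemma conj_coltriv_col i j : (j <= k)%N -> mx (g^-1 * u * g)%g i j = (i == j)%:R.
Proof.
move=> le_jk; rewrite conj_coltriv // !mxE big1 ?addr0 // => m _.
by rewrite !mxE (coltrivP _ _ tu) // subrr mulr0.
Qed.

Lemma conj_coltriv_row i j : (k <= i)%N -> mx (g^-1 * u * g)%g i j = mx u i j.
Proof.
move=> le_ki; rewrite conj_coltriv // mxE [(_ *m _) i j]mxE (bigD1 i) //=.
rewrite (fixrowsP _ (fixrowsV fg)) // eqxx mul1r big1 ?addr0 => [|m mi].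
  by rewrite !mxE addrC subrK.
by rewrite (fixrowsP _ (fixrowsV fg)) // eq_sym (negPf mi) mul0r.
Qed.

Lemma conj_coltriv_unitri : (g^-1 * u * g)%g \in U.
Proof.
apply/unitriP=> i j le_ji; have [le_ki|lt_ik] := leqP k i.
  by rewrite conj_coltriv_row // (unitriP _ Uu).
by rewrite conj_coltriv_col // (leq_trans le_ji) // ltnW.
Qed.

Lemma conj_coltriv_coltriv : coltriv k.+1 (g^-1 * u * g)%g.
Proof. by apply/coltrivP=> i j lt; apply: conj_coltriv_col. Qed.

End ConjColtriv.
End Column.

Section Eigenvectors.
Variables (F : finFieldType) (n : nat) (G : linear_group F n) (R : idomainType).
Local Notation N := n.+1.
Local Notation U := (lg_unitri G).
Local Notation A := (galg R G).
Implicit Types (g h u v : G) (i j k : 'I_N) (a : A) (x y : 'cV[F]_N).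
Implicit Types (w z : A) (c : 'I_N -> F) (b : 'rV[F]_N).

(** The group fixing the rows from [k] on is transitive on non-zero linear forms in
    the first [k] coordinates, so that any form can be moved to a multiple of the
    last of these coordinates. *)
Lemma move_row k b : exists g (r : F), fixrows k g /\
  forall y, low k y ->
    (b *m (mx g^-1 *m y)) 0 0 = r * \sum_(i : 'I_N | k == i.+1 :> nat) y i 0.
Proof.
have [b0|[i0 /andP[lt_i0 bi0]]] :
    (forall i, (i < k)%N -> b 0 i = 0) \/ exists i, (i < k)%N && (b 0 i != 0).
  have [/existsP|/existsPn no_i] := boolP [exists i : 'I_N, (i < k)%N && (b 0 i != 0)].
    by right.
  left=> i lt_ik; apply/eqP/negPn/negP=> bi0; case/negP: (no_i i).
  by rewrite lt_ik.
  exists 1%g, 0; split=> [|y /lowP ly].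
    by apply/forallP=> i; apply/implyP=> _; rewrite mx1.
  rewrite invg1 mx1 mul1mx mul0r mxE big1 // => i _.
  by have [le_ki|/b0->] := leqP k i; rewrite ?mul0r // ly ?mulr0.
have k_gt0 : (0 < k)%N by apply: leq_ltn_trans lt_i0.
have lt_l : (k.-1 < N)%N by apply: leq_ltn_trans (leq_pred k) _.
pose l := Ordinal lt_l; have kl : k = l.+1 :> nat by rewrite /= prednK.
pose b' : 'rV[F]_N := \row_i (if (i < k)%N then b 0 i else 0).
have b'i0 : b' 0 i0 != 0 by rewrite mxE lt_i0.
(* With [e] the row vector of [l], the matrix [1 + c (b' - e)] has row [l] equal to
   [b'] when [e c = 1], and it is invertible when [b' c != 0]. *)
pose c : 'cV[F]_N :=
  delta_mx l 0 + (if b' 0 l != 0 then 0 else delta_mx i0 0).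
have cl : c l 0 = 1.
  rewrite /c mxE; case: ifP => [_|/negPn b'l]; first by rewrite !mxE !eqxx addr0.
  have nli : (l == i0) = false by apply: contraNF b'i0 => /eqP<-.
  by rewrite !mxE !eqxx nli addr0.
have b'c : (b' *m c) 0 0 != 0.
  rewrite /c mulmxDr mxE -colE mxE; case: ifP => [b'l|/negPn/eqP b'l].
    by rewrite mulmx0 [X in _ + X]mxE addr0.
  by rewrite b'l add0r -colE mxE.
have c_high i : (k <= i)%N -> c i 0 = 0.
  move=> le_ki; have il : (i == l) = false by rewrite -val_eqE gtn_eqF // -kl.
  have ii0 : (i == i0) = false by rewrite -val_eqE gtn_eqF // (leq_trans lt_i0).
  by rewrite /c mxE; case: ifP => _; rewrite !mxE ?il ?ii0 /= ?addr0.
pose r : 'rV[F]_N := b' - delta_mx 0 l.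
pose g := toGL G (1%:M + c *m r).
have rc : (r *m c) 0 0 = (b' *m c) 0 0 - 1.
  rewrite /r mulmxBl mxE; congr (_ + _).
  by rewrite mxE -rowE mxE cl.
have gE : mx g = 1%:M + c *m r.
  by rewrite toGLK // rank_one_update_unit // rc addrC subrK.
have fg : fixrows k g.
  by apply/fixrowsP=> i j le_ki; rewrite gE !mxE big_ord1 c_high // mul0r addr0.
have elg : delta_mx 0 l *m mx g = b'.
  rewrite gE mulmxDr mulmx1 mulmxA -rowE.
  have -> : row l c = 1%:M by apply/matrixP=> i j; rewrite !ord1 mxE cl mxE.
  by rewrite mul1mx /r addrC subrK.
exists g, 1; split=> // y ly; rewrite mul1r.
have /lowP lgy := low_fixrows (fixrowsV fg) ly.
have -> : b *m (mx g^-1 *m y) = b' *m (mx g^-1 *m y).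
  apply/matrixP=> i j; rewrite !ord1 !mxE; apply: eq_bigr => m _.
  rewrite [b' 0 m]mxE; case: ifP => // /negbT; rewrite -leqNgt => le_km.
  by rewrite lgy // !mulr0.
rewrite -elg -mulmxA (mulmxA (mx g)) -mxM mulgV mx1 mul1mx -rowE mxE.
rewrite (big_pred1 l) // => i; rewrite /= -val_eqE kl eqSS eq_sym.
by [].
Qed.

Variable psi : F -> R.
Hypotheses (psi0 : psi 0 = 1) (psiD : forall s t : F, psi (s + t) = psi s * psi t).
Hypothesis psi_nontrivial : exists s : F, psi s != 1.
Hypothesis unit_q : (#|F|%:R : R) \is a GRing.unit.

Lemma psi_unit (a : F) : psi a \is a GRing.unit.
Proof. by apply/unitrPr; exists (psi (- a)); rewrite -psiD subrr. Qed.

Definition superdiag c u : F :=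
  \sum_(i : 'I_N) \sum_(j : 'I_N | j == i.+1 :> nat) c j * mx u i j.

(** [w] is an eigenvector of the unitriangular matrices with trivial first [d]
    columns, for a character that factors through the superdiagonal. *)
Definition eigen (d : nat) c w := forall u, u \in U -> coltriv d u ->
  gelt u * w = psi (superdiag c u) *: w.

Lemma eigen_mull k g c w : fixrows k g -> eigen k.+1 c w ->
  eigen k.+1 c (gelt g * w).
Proof.
move=> fg ew u Uu tu.
have -> : gelt u * (gelt g * w) = gelt g * (gelt (g^-1 * u * g)%g * w).
  by rewrite !geltMA !mulgA mulgV mul1g.
rewrite ew; [|exact: conj_coltriv_unitri fg Uu tu|exact: conj_coltriv_coltriv fg tu].
rewrite galgMZr; congr (psi _ *: _).
apply: eq_bigr => i _; apply: eq_bigr => j /eqP ji; congr (_ * _).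
have [le_ki|lt_ik] := leqP k i; first by rewrite (conj_coltriv_row fg tu).
have le_jk : (j <= k)%N by rewrite ji.
by rewrite (conj_coltriv_col fg tu) // (coltrivP _ _ tu).
Qed.

Lemma eigenZ d c r w : eigen d c w -> eigen d c (r *: w).
Proof.
by move=> ew u Uu tu; rewrite galgMZr ew // !scalerA mulrC.
Qed.

Lemma eigen_sum d c (I : Type) (e : seq I) (Q : pred I) (f : I -> A) :
  (forall q, Q q -> eigen d c (f q)) -> eigen d c (\sum_(q <- e | Q q) f q).
Proof.
move=> ef u Uu tu; rewrite mulr_sumr scaler_sumr.
by apply: eq_bigr => q Qq; apply: ef.
Qed.

(** Up to the factor [#|F| ^ k], the projection onto the vectors on which the group
    of column [k] acts through [psi] and the linear form [b]. *)
Definition col_proj k b : A :=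
  \sum_(x | low k x) psi (- (b *m x) 0 0) *: gelt (colGL G k x).

(** By orthogonality only [x = 0] contributes. The factor is [#|F| ^ N] because
    [b] ranges over forms in all coordinates. *)
Lemma col_proj_sum k : \sum_b col_proj k b = (#|F| ^ N)%:R *: (1 : A).
Proof.
rewrite exchange_big /= (bigD1 0) ?low0 //= -scaler_suml [X in _ + X]big1.
  rewrite addr0 colGL0; congr (_ *: _).
  rewrite (eq_bigr (fun=> 1)) => [|b _]; last by rewrite mulmx0 mxE oppr0 psi0.
  by rewrite sumr_const card_mx mul1n.
move=> x /andP[_ x0]; rewrite -scaler_suml.
rewrite (eq_bigr (fun b : 'rV_N => psi ((b *m (- x)) 0 0))) => [|b _]; last first.
  by rewrite mulmxN [in RHS]mxE.
by rewrite additive_character_sum // oppr_eq0 (negPf x0) scale0r.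
Qed.

Lemma colGL_col_proj k b y : low k y ->
  gelt (colGL G k y) * col_proj k b = psi ((b *m y) 0 0) *: col_proj k b.
Proof.
move=> ly; rewrite /col_proj mulr_sumr scaler_sumr (reindex_inj (addrI (- y))) /=.
have lyx x : low k (- y + x) = low k x.
  apply/idP/idP=> [lyx|lx]; last by rewrite lowD ?lowN.
  by rewrite -[x](addNKr y) addrC lowD // addrC.
apply: eq_big => [x|x]; first exact: lyx.
rewrite lyx => lx; rewrite galgMZr geltM -colGLD ?lowD ?lowN // addrA subrr add0r scalerA.
by rewrite -psiD mulmxDr mulmxN mxE [X in - (X + _)]mxE opprD opprK.
Qed.

Variable J : A -> Prop.
Hypotheses (J0 : J 0) (JD : forall z w, J z -> J w -> J (z + w)).
Hypothesis JM : forall a w, J w -> J (a * w).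

Lemma J_scale r w : J w -> J (r *: w).
Proof. by move=> Jw; rewrite -[w]mul1r -galgMZl; apply: JM. Qed.

Lemma exists_col_proj k w : ~ J w -> exists b, ~ J (col_proj k b * w).
Proof.
move=> nJw; apply: contrapT => no_b; apply: nJw.
have uqN : ((#|F| ^ N)%:R : R) \is a GRing.unit by rewrite natrX unitrX.
suff JqN : J ((#|F| ^ N)%:R *: w).
  by rewrite -[w]scale1r -(mulVr uqN) -scalerA; apply: J_scale.
rewrite -[w]mul1r -galgMZl -(col_proj_sum k) mulr_suml.
elim/big_ind: _ => // b _; apply: contrapT => nJb.
by apply: no_b; exists b.
Qed.

(** Descending from column [k.+1] to column [k]: decompose under the column
    group, and move the linear form found there to one that only involves the
    row above the diagonal. *)
Lemma eigen_step k c w : eigen k.+1 c w -> ~ J w ->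
  exists a c', ~ J (a * w) /\ eigen k c' (a * w).
Proof.
move=> ew /(exists_col_proj k)[b nJb].
have [g [r [fg gb]]] := move_row k b.
set w1 := col_proj k b * w in nJb.
have ew1 : eigen k.+1 c w1.
  rewrite /w1 /col_proj mulr_suml; apply: eigen_sum => x lx.
  by rewrite galgMZl; apply/eigenZ/eigen_mull => //; apply: fixrows_colGL.
have ew2 := eigen_mull fg ew1; set w2 := gelt g * w1 in ew2.
pose c' j := if j == k then r else c j.
exists (gelt g * col_proj k b), c'; rewrite -mulrA -/w1 -/w2; split.
  move=> Jw2; apply: nJb; rewrite -[w1]gelt1M -(mulVg g) -geltMA.
  exact: JM.
move=> u Uu /coltrivP tu.
(* Write [u] as the product of an element [colGL x] of the column group and some
   [u'] whose column [k] is trivial. *)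
pose x : 'cV[F]_N := \col_i (if (i < k)%N then mx u i k else 0).
have lx : low k x by apply/lowP=> i le_ki; rewrite mxE ltnNge le_ki.
pose u' := (colGL G k (- x) * u)%g.
have uE : u = (colGL G k x * u')%g.
  by rewrite mulgA -colGLD ?lowN // subrr colGL0 mul1g.
have Uu' : u' \in U by rewrite groupM // colGL_unitri ?lowN.
have u'E i j : mx u' i j = mx u i j - x i 0 * mx u k j.
  rewrite mxM colGLE ?lowN // mulmxDl mul1mx mxE; congr (_ + _).
  by rewrite -mulmxA -rowE mxE big_ord1 !mxE mulNr.
have tu' : coltriv k.+1 u'.
  apply/coltrivP=> i j; rewrite ltnS u'E leq_eqVlt => /predU1P[/val_inj->|lt_jk].
    rewrite (unitriP _ Uu k k) // eqxx mulr1 mxE.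
    case: ltnP => [lt_ik|le_ki]; last by rewrite subr0 (unitriP _ Uu).
    by rewrite subrr -val_eqE ltn_eqF.
  by rewrite !tu // -[k == j]val_eqE gtn_eqF // mulr0 subr0.
have sE : superdiag c' u =
    superdiag c u' + r * \sum_(i : 'I_N | k == i.+1 :> nat) x i 0.
  rewrite mulr_sumr [in X in _ + X]big_mkcond -big_split /=.
  apply: eq_bigr => i _.
  have [lt_i|le_Ni] := ltnP i.+1 N; last first.
    rewrite !big_pred0 ?add0r; last 2 first.
    - by move=> j; apply/negP=> /eqP ji; move: (ltn_ord j); rewrite ji ltnNge le_Ni.
    - by move=> j; apply/negP=> /eqP ji; move: (ltn_ord j); rewrite ji ltnNge le_Ni.
    by case: eqP => // ki; move: (ltn_ord k); rewrite ki ltnNge le_Ni.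
  pose j := Ordinal lt_i.
  rewrite !(big_pred1 j) => [|j'|j']; last 2 first.
  - by rewrite /= -val_eqE.
  - by rewrite /= -val_eqE.
  rewrite /c' u'E -val_eqE /= [(k : nat) == _]eq_sym.
  have [ik|nik] := eqVneq i.+1 (k : nat).
    have jk : j = k by apply: val_inj.
    rewrite jk (unitriP _ Uu k k) // eqxx mulr1 mxE -ik leqnn subrr mulr0 add0r.
    by [].
  rewrite addr0; have [lt_ik|le_ki] := ltnP i k; last first.
    by rewrite [x i 0]mxE ltnNge le_ki mul0r subr0.
  have lt_jk : (j < k)%N by rewrite ltn_neqAle nik.
  by rewrite !tu // -[k == j]val_eqE gtn_eqF // mulr0 subr0.
rewrite {1}uE -geltMA ew2 // galgMZr sE psiD -scalerA; congr (_ *: _).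
have lgx : low k (mx g^-1%g *m x) by rewrite low_fixrows ?fixrowsV.
rewrite /w2 geltMA colGL_conj // -geltMA /w1 [gelt (colGL _ _ _) * _]mulrA.
by rewrite colGL_col_proj // galgMZl gb // galgMZr.
Qed.

(** [J] plays the role of the zero submodule: the eigenvector is constructed
    outside [J], but it is an exact eigenvector. That its eigencharacter is
    multiplicative follows from its being non-zero. *)
Theorem exists_eigenvector w : ~ J w ->
  exists a lam, [/\ linear_character (G := G) (R := R) lam, ~ J (a * w) &
    forall u, u \in U -> gelt u * (a * w) = (lam u)^-1 *: (a * w)].
Proof.
move=> nJw.
have step d : (d <= N)%N -> exists a c, ~ J (a * w) /\ eigen (N - d) c (a * w).
  elim: d => [_|d IHd lt_d].
    exists 1, (fun=> 0); rewrite mul1r; split=> // u _ /coltrivP tu.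
    have -> : u = 1%g by apply: mxP => i j; rewrite mx1 mxE tu // subn0.
    rewrite gelt1M /superdiag big1 ?psi0 ?scale1r // => i _.
    by rewrite big1 // => j _; rewrite mul0r.
  have [a [c [nJa ea]]] := IHd (ltnW lt_d).
  have lt_k : (N - d.+1 < N)%N by rewrite ltn_subrL.
  have [|a' [c' [nJa' ea']]] := @eigen_step (Ordinal lt_k) c (a * w) _ nJa.
    by rewrite /= subnSK.
  by exists (a' * a), c'; rewrite -mulrA.
have [a [c [nJa]]] := step N (leqnn _); rewrite subnn => ea.
pose th u := psi (superdiag c u).
have {}ea u : u \in U -> gelt u * (a * w) = th u *: (a * w).
  by move=> Uu; apply: ea => //; apply/coltrivP.
have [h awh] : exists h, galg_coef (a * w) h != 0.
  apply: contrapT => no_h; apply: nJa; rewrite (_ : a * w = 0) //.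
  apply: galgP => h; rewrite galg0; apply/eqP/negPn/negP=> awh.
  by apply: no_h; exists h.
have thM : {in U &, {morph th : u v / (u * v)%g >-> u * v}}.
  move=> u v Uu Uv; apply: (mulIf awh); rewrite -!galgZ -ea ?groupM //.
  by rewrite -geltMA ea // galgMZr ea // scalerA mulrC.
exists a, (fun u => (th u)^-1); split=> // [|u Uu]; last by rewrite invrK ea.
split=> [u Uu|u v Uu Uv]; first by rewrite unitrV psi_unit.
by rewrite thM // invrM ?psi_unit // mulrC.
Qed.

End Eigenvectors.

(** * A criterion for absolute irreducibility *)

Section FunctionalQuotient.
Variables (K : fieldType) (gT : finGroupType).
Local Notation A := (galg K gT).
Implicit Types (a b c : A) (g h : gT).
Variable kappa : A -> K.
Hypotheses (kappaD : forall a b, kappa (a + b) = kappa a + kappa b).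
Hypothesis kappaZ : forall r a, kappa (r *: a) = r * kappa a.

Lemma kappa_sum (I : Type) (e : seq I) (Q : pred I) (f : I -> A) :
  kappa (\sum_(q <- e | Q q) f q) = \sum_(q <- e | Q q) kappa (f q).
Proof.
apply: (big_morph kappa) => [a b|]; first exact: kappaD.
by rewrite -[0 in LHS](scale0r (0 : A)) kappaZ mul0r.
Qed.

(** The quotient of the group algebra by the largest left ideal on which
    [kappa] vanishes, in coordinates: the matrix of [kappa (g * h)] is factored
    through a space whose dimension is its rank. *)
Lemma functional_quotient : exists d (X : A -> 'cV[K]_d),
  [/\ forall r a b, X (r *: a + b) = r *: X a + X b,
      forall x, exists a, X a = x,
      forall a, X a = 0 <-> (forall h, kappa (gelt h * a) = 0)
    & forall j, exists b, forall c, X c j 0 = kappa (b * c)].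
Proof.
pose m := #|{: gT}|.
pose ofA a : 'cV[K]_m := \col_i a (enum_val i).
pose Gam : 'M[K]_m := \matrix_(i, j) kappa (gelt (enum_val i) * gelt (enum_val j)).
have GamE a i : (Gam *m ofA a) i 0 = kappa (gelt (enum_val i) * a).
  rewrite {2}[a]galg_expand mulr_sumr kappa_sum mxE.
  rewrite (reindex (@enum_val gT predT)) /=; last exact: onW_bij (enum_val_bij gT).
  by apply: eq_bigr => j _; rewrite !mxE galgMZr kappaZ mulrC.
pose D := row_base Gam; pose C := col_base Gam.
have CD : C *m D = Gam := mulmx_base Gam.
have C1 : pinvmx C *m C = 1%:M by apply: mulVpmx; apply: col_base_full.
have D1 : D *m pinvmx D = 1%:M by apply: mulmxVp; apply: row_base_free.
have DE : D = pinvmx C *m Gam.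
  rewrite -[LHS]mul1mx -C1 -mulmxA; exact: (congr1 (mulmx (pinvmx C)) CD).
exists (\rank Gam), (fun a => D *m ofA a); split.
- move=> r a b; rewrite scalemxAr -mulmxDr; congr (_ *m _).
  by apply/matrixP=> i j; rewrite !mxE galgD galgZ.
- move=> x; exists (\sum_g (pinvmx D *m x) (enum_rank g) 0 *: gelt g).
  rewrite -[RHS]mul1mx -D1 -mulmxA; congr (_ *m _); apply/matrixP=> i j.
  rewrite (ord1 j) mxE galg_sum (bigD1 (enum_val i)) //= galgZ geltE eqxx mulr1.
  rewrite enum_valK big1 ?addr0 // => g ng.
  by rewrite galgZ geltE eq_sym (negPf ng) mulr0.
- move=> a; split=> [Da h|ka].
    have : C *m (D *m ofA a) = 0 by rewrite Da mulmx0.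
    rewrite mulmxA CD => /matrixP/(_ (enum_rank h) 0).
    by rewrite GamE enum_rankK mxE.
  rewrite DE -mulmxA [X in _ *m X](_ : _ = 0) ?mulmx0 //.
  by apply/matrixP=> i j; rewrite (ord1 j) GamE ka mxE.
move=> j; exists (\sum_i pinvmx C j i *: gelt (enum_val i)) => c.
rewrite DE -mulmxA mxE mulr_suml kappa_sum.
by apply: eq_bigr => i _; rewrite GamE galgMZl kappaZ.
Qed.

End FunctionalQuotient.

Section Criterion.
Variables (K : fieldType) (gT : finGroupType) (W : lmodType (galg K gT)).
Local Notation A := (galg K gT).
Implicit Types (a b c : A) (g h : gT) (r : K).
Variables (v : W) (e : A).
Hypotheses (v0 : v != 0) (ev : e *: v = v).
Hypothesis e_line : forall a, exists r, (e * a) *: v = (r *: (1 : A)) *: v.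
Hypothesis v_gen : forall a, a *: v != 0 -> exists b, (b * a) *: v = v.

Lemma scale_line r : (r *: (1 : A)) *: v = 0 -> r = 0.
Proof.
move=> rv; apply/eqP; apply: contraNT v0 => r0.
have -> : v = (r^-1 *: (1 : A)) *: ((r *: (1 : A)) *: v).
  by rewrite scalerA galgMZl mul1r scalerA mulVf // !scale1r.
by rewrite rv scaler0.
Qed.

Let kappa a : K := sval (cid (e_line a)).

Let kappaE a : (e * a) *: v = (kappa a *: (1 : A)) *: v.
Proof. exact: (svalP (cid (e_line a))). Qed.

Let kappa_uniq a r : (e * a) *: v = (r *: (1 : A)) *: v -> kappa a = r.
Proof.
rewrite kappaE => /eqP; rewrite -subr_eq0 -scalerBl -scalerBl => /eqP/scale_line.
by move/eqP; rewrite subr_eq0 => /eqP.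
Qed.

Let kappaD a b : kappa (a + b) = kappa a + kappa b.
Proof. by apply: kappa_uniq; rewrite mulrDr scalerDl !kappaE !scalerDl. Qed.

Let kappaZ r a : kappa (r *: a) = r * kappa a.
Proof.
apply: kappa_uniq; rewrite galgMZr -scalerA -[e * a]mul1r -galgMZl -scalerA.
by rewrite kappaE scalerA galgMZl mul1r.
Qed.

Let kappa_null a : a *: v = 0 <-> (forall h, kappa (gelt h * a) = 0).
Proof.
split=> [av h|ka].
  by apply: kappa_uniq; rewrite mulrA -scalerA av scaler0 !scale0r.
apply/eqP/negPn/negP=> /v_gen[b bav].
have : kappa (b * a) = 1.
  by apply: kappa_uniq; rewrite -scalerA bav ev !scale1r.
rewrite [b]galg_expand mulr_suml (kappa_sum kappaD kappaZ) big1 => [|h _].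
  by move/eqP; rewrite eq_sym oner_eq0.
by rewrite galgMZl kappaZ ka mulr0.
Qed.

(** If [e] projects the module generated by [v] onto the line of [v], and every
    non-zero submodule contains [v], then the operators [a * e * b] already
    span all endomorphisms. *)
Theorem line_criterion (M : {pred W}) :
  (forall w, (w \in M) <-> (exists a, w = a *: v)) -> absolutely_irreducible M.
Proof.
move=> ME; have [d [X [Xlin Xsurj Xker Xrow]]] := functional_quotient kappaD kappaZ.
have X0 : X 0 = 0 by have := Xlin (-1) 0 0; rewrite scaler0 addr0 scaleN1r addNr.
have XD a b : X (a + b) = X a + X b by rewrite -{1}[a]scale1r Xlin scale1r.
have XZ r a : X (r *: a) = r *: X a by rewrite -[r *: a]addr0 Xlin X0 addr0.
have Xsum (I : Type) (s : seq I) (Q : pred I) (f : I -> A) :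
    X (\sum_(q <- s | Q q) f q) = \sum_(q <- s | Q q) X (f q).
  exact: (big_morph X XD X0).
have XB a b : X (a - b) = X a - X b by rewrite XD -scaleN1r XZ scaleN1r.
have Xv a b : X a = X b <-> a *: v = b *: v.
  split=> [Xab|avbv].
    apply/eqP; rewrite -subr_eq0 -scalerBl; apply/eqP/kappa_null/Xker.
    by rewrite XB Xab subrr.
  by apply/eqP; rewrite -subr_eq0 -XB; apply/eqP/Xker/kappa_null; rewrite scalerBl avbv subrr.
pose sX (j : 'I_d) := sval (cid (Xsurj (delta_mx j 0))).
have XsX j : X (sX j) = delta_mx j 0 := svalP (cid (Xsurj (delta_mx j 0))).
pose sec (x : 'cV[K]_d) : A := \sum_j x j 0 *: sX j.
have Xsec x : X (sec x) = x.
  rewrite Xsum [RHS]matrix_sum_delta; apply: eq_bigr => j _.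
  by rewrite big_ord1 XZ XsX.
pose rho g : 'M[K]_d := \matrix_(i, j) X (gelt g * sX j) i 0.
have rhoX g b : rho g *m X b = X (gelt g * b).
  have -> : X (gelt g * b) = X (gelt g * sec (X b)).
    by apply/Xv; rewrite -!scalerA; congr (_ *: _); apply/Xv; rewrite Xsec.
  rewrite mulr_sumr Xsum; apply/matrixP=> i j; rewrite (ord1 j) mxE summxE.
  by apply: eq_bigr => k _; rewrite galgMZr XZ !mxE mulrC.
have eqX (P Q : 'M[K]_d) : (forall b, P *m X b = Q *m X b) -> P = Q.
  move=> PQ; apply/matrixP=> i j; have := PQ (sX j); rewrite XsX -!colE.
  by move/matrixP/(_ i 0); rewrite !mxE.
pose rhoA a := \sum_g a g *: rho g.
have rhoAX a b : rhoA a *m X b = X (a * b).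
  rewrite {2}[a]galg_expand mulr_suml Xsum mulmx_suml; apply: eq_bigr => g _.
  by rewrite -scalemxAl rhoX galgMZl XZ.
have rhoAM a b : rhoA (a * b) = rhoA a *m rhoA b.
  by apply: eqX => c; rewrite -mulmxA !rhoAX mulrA.
have rhoAD a b : rhoA (a + b) = rhoA a + rhoA b.
  by apply: eqX => c; rewrite mulmxDl !rhoAX mulrDl XD.
have rhoAZ r a : rhoA (r *: a) = r *: rhoA a.
  by apply: eqX => c; rewrite -scalemxAl !rhoAX galgMZl XZ.
have rho_repr : mx_repr [set: gT] rho.
  split=> [|g h _ _]; apply: eqX => b.
    by rewrite rhoX gelt1M mul1mx.
  by rewrite -mulmxA !rhoX geltMA.
pose rep := MxRepresentation rho_repr.
exists d, rep; split.
  exists (fun x => sec x *: v); split.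
  - by move=> x y /Xv; rewrite !Xsec.
  - by move=> x y; rewrite -scalerDl; apply/Xv; rewrite XD !Xsec.
  - move=> a x; rewrite scalerA; apply/Xv.
    by rewrite Xsec -[x in LHS]Xsec; apply: rhoAX.
  move=> w; rewrite ME; split=> [[a ->]|[x ->]]; last by exists (sec x).
  by exists (X a); apply/Xv; rewrite Xsec.
have X1 : X 1 != 0.
  apply: contraNneq v0 => X1; rewrite -[v]scale1r -(scale0r v); apply/eqP/Xv.
  by rewrite X1 X0.
apply/andP; split.
  rewrite lt0n; apply: contraNneq X1 => d0; apply/eqP/matrixP=> -[i lt_i].
  by exfalso; rewrite d0 in lt_i.
have rhoA_in a : (rhoA a \in enveloping_algebra_mx rep)%MS.
  rewrite linear_sum summx_sub // => g _; rewrite linearZ scalemx_sub //.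
  by rewrite (envelop_mx_id rep) ?inE.
pose krow : 'rV[K]_d := \row_j kappa (sX j).
have krowX b : krow *m X b = (kappa b)%:M.
  have -> : kappa b = kappa (sec (X b)).
    have : X b = X (sec (X b)) by rewrite Xsec.
    by move/Xv=> bE; apply: kappa_uniq; rewrite -scalerA bE scalerA kappaE.
  apply/matrixP=> i j; rewrite !ord1 [RHS]mxE mxE (kappa_sum kappaD kappaZ).
  by apply: eq_bigr => k _; rewrite mxE kappaZ mulrC.
(* [e] acts as a matrix of rank one, whose column and row each generate. *)
have rhoe : rhoA e = X 1 *m krow.
  apply: eqX => b; rewrite rhoAX -mulmxA krowX mul_mx_scalar -XZ.
  by apply/Xv; rewrite kappaE.
have all_rho P : exists a, P = rhoA a.
  have delta_rho i j : exists a, delta_mx i j = rhoA a.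
    have [b bE] := Xrow j; exists (sX i * e * b).
    rewrite !rhoAM rhoe mulmxA rhoAX mulr1 XsX -mulmxA.
    suff -> : krow *m rhoA b = delta_mx 0 j by rewrite mul_delta_mx.
    apply/matrixP=> i' k; rewrite (ord1 i').
    have : krow *m rhoA b *m X (sX k) = delta_mx 0 j *m X (sX k).
      rewrite -mulmxA rhoAX krowX -bE -rowE; apply/matrixP=> s t.
      by rewrite !ord1 !mxE.
    by rewrite XsX -!colE => /matrixP/(_ 0 0); rewrite !mxE.
  rewrite [P]matrix_sum_delta.
  elim/big_ind: _ => [|P1 P2 [a ->] [b ->]|i _].
  - by exists 0; rewrite /rhoA big1 // => g _; rewrite galg0 scale0r.
  - by exists (a + b); rewrite rhoAD.
  elim/big_ind: _ => [|P1 P2 [a ->] [b ->]|j _].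
  - by exists 0; rewrite /rhoA big1 // => g _; rewrite galg0 scale0r.
  - by exists (a + b); rewrite rhoAD.
  by have [a ->] := delta_rho i j; exists (P i j *: a); rewrite rhoAZ.
rewrite -sub1mx; apply/row_subP=> i.
have [a aE] := all_rho (vec_mx (row i 1%:M)).
by rewrite -[row i _]vec_mxK aE.
Qed.

End Criterion.

(** * Additive characters of a finite field *)

(** Compose a coordinate of [F] over its prime field with the powers of [z]. *)
Lemma exists_additive_character (F : finFieldType) p (R : idomainType) (z : R) :
    p \in [pchar F] -> p.-primitive_root z ->
  exists psi : F -> R, [/\ psi 0 = 1,
    forall s t : F, psi (s + t) = psi s * psi t & exists s : F, psi s != 1].
Proof.
move=> pF prim_z; have pr_p := pcharf_prime pF.
pose V : vectType 'F_p := pPrimeCharType pF.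
pose X := vbasis {: V}.
pose f i (s : V) : 'F_p := coord X i s.
have [i fi] : exists i, f i 1 != 0.
  apply: contrapT => no_i; have /eqP[] := oner_neq0 F.
  have -> : (1 : F) = \sum_i f i 1 *: (X`_i : V).
    exact: (coord_vbasis (memvf (1 : V))).
  rewrite big1 // => i _; case: (eqVneq (f i 1) 0) => [->|fi]; first exact: scale0r.
  by case: no_i; exists i.
have valD (a b : 'F_p) : z ^+ (a + b)%R = z ^+ a * z ^+ b.
  rewrite -exprD -[RHS](prim_expr_mod prim_z); congr (_ ^+ (_ %% _)%N).
  exact: Fp_cast.
exists (fun s => z ^+ (f i s)); split=> [|s t|].
- by rewrite /f linear0.
- by rewrite /f linearD valD.
exists 1; rewrite -(prim_order_dvd prim_z) gtnNdvd ?lt0n //.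
exact: leq_trans (ltn_ord (f i 1)) (eq_leq (Fp_cast pr_p)).
Qed.

Lemma card_unit (F : finFieldType) p (R : idomainType) l :
    local_with_maximal_ideal (l%:R : R) -> prime l -> p \in [pchar F] -> l != p ->
  (#|F|%:R : R) \is a GRing.unit.
Proof.
move=> locR pr_l pF lp; apply: (local_nat_unit locR pr_l).
have pr_p := pcharf_prime pF.
rewrite (card_pprimeChar pF) Euclid_dvdX // dvdn_prime2 // (negPf lp) //.
Qed.

(** * Submodules of the filtration quotient *)

Section Filtration.
Variables (F : finFieldType) (n : nat) (G : linear_group F n) (R : idomainType).
Variables (l p : nat) (z : R).
Hypotheses (pr_l : prime l) (pF : p \in [pchar F]) (lp : l != p).
Hypotheses (R0 : [pchar R] =i pred0) (locR : local_with_maximal_ideal (l%:R : R)).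
Hypothesis prim_z : p.-primitive_root z.
Local Notation U := (lg_unitri G).
Local Notation B := (lg_borel G).
Local Notation A := (galg R G).
Local Notation eps := (@st_eps F n G R).
Local Notation st_ideal := (@st_ideal F n G R).
Local Notation linear_character := (@linear_character F n G R).
Implicit Types (g u : G) (a b w x y : A) (r : R) (c d : nat) (lam mu : G -> R).

Lemma natr_neq0 m : (0 < m)%N -> (m%:R : R) != 0.
Proof.
move=> m_gt0; apply/negP=> /eqP m0.
have [q] := natf0_pchar m_gt0 (introT eqP m0).
by rewrite R0.
Qed.

Let l0 : (l%:R : R) != 0. Proof. exact/natr_neq0/prime_gt0. Qed.
Let B0 : (#|B|%:R : R) != 0. Proof. exact/natr_neq0/(cardG_gt0 (borel_group G)). Qed.

Lemma unit_U : (#|U|%:R : R) \is a GRing.unit.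
Proof.
have -> : U = pattern G (fun i j => (i < j)%N).
  by apply/setP=> g; apply/unitriP/patternP=> Ug i j; have := Ug i j; rewrite -leqNgt.
by rewrite card_upper_pattern // natrX unitrX // (card_unit locR pr_l pF).
Qed.

Lemma unit_sub r s : r \is a GRing.unit -> r - l%:R * s \is a GRing.unit.
Proof.
move=> ur; apply: (local_unit locR) => t /eqP; rewrite subr_eq -mulrDr => /eqP rE.
apply: (@uniformizer_nonunit _ _ locR ((t + s) * r^-1)).
by rewrite mulrA -rE divrr.
Qed.

Lemma st_ideal_mul a x : st_ideal x -> st_ideal (a * x).
Proof. by case=> b ->; exists (a * b); rewrite mulrA. Qed.

Lemma st_idealD x y : st_ideal x -> st_ideal y -> st_ideal (x + y).
Proof. by case=> a -> [b ->]; exists (a + b); rewrite mulrDl. Qed.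

Lemma st_idealZ r x : st_ideal x -> st_ideal (r *: x).
Proof. by case=> a ->; exists (r *: a); rewrite galgMZl. Qed.

Lemma st_ideal0 : st_ideal 0.
Proof. by exists 0; rewrite mul0r. Qed.

Lemma st_ideal_eps : st_ideal eps.
Proof. by exists 1; rewrite mul1r. Qed.

Lemma st_ideal_stE lam : st_ideal (stE lam).
Proof. by exists (proj lam). Qed.

(** The normalized form [dot / #|B|] of two elements lies in [l ^ c]. *)
Definition form_in c x y := exists r, dot x y = #|B|%:R * (l%:R ^+ c * r).

Lemma form_inDl c x x' y : form_in c x y -> form_in c x' y -> form_in c (x + x') y.
Proof. by move=> [r xy] [r' xy']; exists (r + r'); rewrite dotDl xy xy' !mulrDr. Qed.

Lemma form_inZl c r x y : form_in c x y -> form_in c (r *: x) y.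
Proof.
by move=> [s xy]; exists (r * s); rewrite dotZl xy mulrCA [r * (_ * s)]mulrCA.
Qed.

Lemma form_in_suml c (I : Type) (e : seq I) (Q : pred I) (f : I -> A) y :
  (forall q, Q q -> form_in c (f q) y) -> form_in c (\sum_(q <- e | Q q) f q) y.
Proof.
move=> fy; elim/big_ind: _ => // [|x x']; last exact: form_inDl.
by exists 0; rewrite !mulr0 /dot big1 // => g _; rewrite galg0 mul0r.
Qed.

Lemma form_inC c x y : form_in c x y -> form_in c y x.
Proof. by rewrite /form_in dotC. Qed.

Lemma form_in_unit c r x y : r \is a GRing.unit -> form_in c (r *: x) y ->
  form_in c x y.
Proof. by move=> ur /(form_inZl r^-1); rewrite scalerA mulVr // scale1r. Qed.

(** [in_I c] is the lattice [I(c)], and [in_J c] is the preimage in [I] of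
    [L(c + 1)], that is, the submodule [I(c + 1) + l I]. *)
Definition in_I c x := st_ideal x /\ forall y, st_ideal y -> form_in c x y.

Definition in_J c x := exists y y', [/\ in_I c.+1 y, st_ideal y' & x = y + y' *+ l].

Lemma in_I_mul c a x : in_I c x -> in_I c (a * x).
Proof.
move=> [Ix xc]; split=> [|y Iy]; first exact: st_ideal_mul.
rewrite [a]galg_expand mulr_suml; apply: form_in_suml => g _.
rewrite galgMZl; apply: form_inZl; rewrite /form_in dot_gelt.
by apply/xc/st_ideal_mul.
Qed.

Lemma in_ID c x y : in_I c x -> in_I c y -> in_I c (x + y).
Proof.
move=> [Ix xc] [Iy yc]; split=> [|y' Iy']; first exact: st_idealD.
by apply: form_inDl; [apply: xc | apply: yc].
Qed.

Lemma in_IZ c r x : in_I c x -> in_I c (r *: x).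
Proof. by move=> Ix; rewrite -[x]mul1r -galgMZl; apply: in_I_mul. Qed.

Lemma in_I0 c : in_I c 0.
Proof.
split=> [|y _]; first exact: st_ideal0.
by exists 0; rewrite !mulr0 /dot big1 // => g _; rewrite galg0 mul0r.
Qed.

Lemma in_IW c d x : (c <= d)%N -> in_I d x -> in_I c x.
Proof.
move=> le_cd [Ix xd]; split=> // y /xd[r xy]; exists (l%:R ^+ (d - c) * r).
by rewrite xy -[in LHS](subnKC le_cd) exprD -!mulrA.
Qed.

Lemma in_I_unit c r x : r \is a GRing.unit -> in_I c (r *: x) -> in_I c x.
Proof. by move=> ur /(in_IZ r^-1); rewrite scalerA mulVr // scale1r. Qed.

Lemma in_J0 c : in_J c 0.
Proof.
exists 0, 0; split; [exact: in_I0 | exact: st_ideal0|].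
by rewrite mul0rn addr0.
Qed.

Lemma in_JD c x y : in_J c x -> in_J c y -> in_J c (x + y).
Proof.
move=> [x1 [x2 [Ix1 Ix2 ->]]] [y1 [y2 [Iy1 Iy2 ->]]].
exists (x1 + y1), (x2 + y2); split; [exact: in_ID | exact: st_idealD|].
by rewrite mulrnDl addrACA.
Qed.

Lemma in_J_mul c a x : in_J c x -> in_J c (a * x).
Proof.
move=> [x1 [x2 [Ix1 Ix2 ->]]]; exists (a * x1), (a * x2).
split; [exact: in_I_mul | exact: st_ideal_mul|].
by rewrite mulrDr mulrnAr.
Qed.

Lemma in_JZ c r x : in_J c x -> in_J c (r *: x).
Proof. by move=> Jx; rewrite -[x]mul1r -galgMZl; apply: in_J_mul. Qed.

Lemma galg_mulrn (x : A) m : x *+ m = (m%:R : R) *: x.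
Proof. by rewrite scaler_nat. Qed.

(** ** Position of the eigenvectors in the filtration *)

Definition pindex mu : nat := #|[set: G] : parabolic_of G (nontrivial_root mu)|%g.

Lemma pindex_gt0 mu : (0 < pindex mu)%N.
Proof. exact: indexg_gt0. Qed.

Lemma stE_in_I c mu : linear_character mu -> (l ^ c %| pindex mu)%N ->
  in_I c (stE mu).
Proof.
move=> muU /dvdnP[m mE]; split=> [|y]; first exact: st_ideal_stE.
move=> /steinberg_span[r ->]; apply/form_inC/form_in_suml => u Uu.
apply/form_inZl/form_inC; exists (mu u * m%:R).
rewrite dotC dot_gelt dotC gelt_stE ?groupV // dotZl dot_stE_eps //.
rewrite -/(pindex mu) mE (characterV muU) // invrK natrM natrX.
by rewrite mulrCA [m%:R * _]mulrC [mu u * (_ * _)]mulrCA.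
Qed.

Lemma stE_in_I_dvd c mu : linear_character mu -> in_I c (stE mu) ->
  (c <= logn l (pindex mu))%N.
Proof.
move=> muU [_ /(_ _ st_ideal_eps)[r]]; rewrite dot_stE_eps // => /(mulfI B0).
rewrite -/(pindex mu) => rE.
have [m lm mE] := pfactor_coprime pr_l (pindex_gt0 mu).
rewrite leqNgt; apply/negP=> lt_c.
have um : (m%:R : R) \is a GRing.unit.
  by apply: (local_nat_unit locR pr_l); rewrite -prime_coprime.
move: rE; rewrite mE natrM natrX -(subnKC lt_c) exprD exprS -!mulrA mulrC.
rewrite [l%:R * (_ * _)]mulrCA => /(mulfI (expf_neq0 _ l0)) mE'.
apply: (@uniformizer_nonunit _ _ locR (l%:R ^+ (c - (logn l (pindex mu)).+1) * r * m%:R^-1)).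
by rewrite !mulrA in mE' *; rewrite -mE' divrr.
Qed.

(** Modulo [l], an eigenvector is determined by its eigencharacter: the error
    term of a congruence is absorbed after projecting. *)
Lemma stE_congr_in_I c mu x x' : linear_character mu ->
  in_I c x -> st_ideal x' -> stE mu = x + x' *+ l -> in_I c (stE mu).
Proof.
move=> muU Ix Ix' eE; have := proj_stE muU; rewrite {1}eE mulrDr mulrnAr.
have [r ->] := proj_ideal muU Ix'; rewrite galg_mulrn scalerA => projE.
apply: (in_I_unit (unit_sub r unit_U)).
by rewrite scalerBl -projE addrK; apply: in_I_mul.
Qed.

(** [E_mu] lies in [I(c)] as long as [l ^ c] divides the index, and adding elements
    of [l I] does not raise its level. *)
Lemma stE_in_J c mu : linear_character mu ->
  in_J c (stE mu) <-> (c < logn l (pindex mu))%N.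
Proof.
move=> muU; split=> [[x [x' [Ix Ix' eE]]]|lt_c].
  by apply: stE_in_I_dvd => //; apply: stE_congr_in_I Ix Ix' eE.
exists (stE mu), 0; split; [|exact: st_ideal0|by rewrite mul0rn addr0].
by apply: stE_in_I; rewrite ?pfactor_dvdn ?pindex_gt0.
Qed.

Section MainCharacter.
Variable lam : G -> R.
Hypothesis lamU : linear_character lam.
Local Notation c := (logn l (pindex lam)).

Lemma stE_in_I_index : in_I c (stE lam).
Proof. by apply: stE_in_I => //; rewrite pfactor_dvdnn. Qed.

Lemma stE_notin_J : ~ in_J c (stE lam).
Proof. by move/(stE_in_J _ lamU); rewrite ltnn. Qed.

Lemma alternating_stE_conj mu : linear_character mu ->
  gelt (alternating G) * stE (conj_char mu) = stE mu.
Proof.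
by move=> muU; rewrite -alternating_stE // geltMA alternatingK gelt1M.
Qed.

(** The value of the form at [E_(1 / mu)] and [E_mu] is [#|U|] times the index,
    and [#|U|] is a unit. *)
Lemma form_conj_level d mu : linear_character mu ->
  form_in d (stE (conj_char mu)) (stE mu) -> (d <= logn l (pindex mu))%N.
Proof.
move=> muU [r]; rewrite dot_stE_conj // mulrCA => /(mulfI B0) rE.
apply: stE_in_I_dvd => //; split=> [|y Iy]; first exact: st_ideal_stE.
have [s ->] := steinberg_span Iy; apply/form_inC/form_in_suml => u Uu.
apply/form_inZl/form_inC; exists (mu u * (#|U|%:R^-1 * r)).
rewrite dotC dot_gelt dotC gelt_stE ?groupV // dotZl dot_stE_eps //.
rewrite (characterV muU) // invrK mulrCA; congr (_ * _).
rewrite mulrCA; congr (_ * _); rewrite mulrCA -rE mulrA mulVr ?mul1r //.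
exact: unit_U.
Qed.

Lemma form_in_suml_ex d a x y : ~ form_in d (a * x) y ->
  exists g, ~ form_in d (gelt g * x) y.
Proof.
move=> nf; apply: contrapT => no_g; apply: nf.
rewrite [a]galg_expand mulr_suml; apply: form_in_suml => g _.
rewrite galgMZl; apply: form_inZl; apply: contrapT => nf.
by apply: no_g; exists g.
Qed.

(** The eigenvector [E_mu] generated by [w] has level [c]. Since [E_mu] is
    congruent to a multiple of [E_lam], its non-trivial pairing with the conjugate
    eigenvector yields a non-trivial pairing of [E_lam] with a translate [x] of
    the latter. Projecting [x] gives the conjugate of [E_lam]. *)
Theorem stE_generated a w j : w = a * stE lam + j -> in_J c j -> ~ in_J c w ->
  exists b, b * w = stE lam.
Proof.
move=> wE Jj nJw.
have [psi [psi0 psiD psi1]] := exists_additive_character pF prim_z.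
have uq := card_unit locR pr_l pF lp.
have [a1 [mu [muU nJ1 eig]]] :=
  exists_eigenvector psi0 psiD psi1 uq (@in_J0 c) (@in_JD c) (@in_J_mul c) nJw.
have Iw : st_ideal w.
  have [y [y' [[Iy _] Iy' jE]]] := Jj; rewrite wE jE galg_mulrn.
  apply: st_idealD; first exact: st_ideal_mul (st_ideal_stE _).
  by apply: st_idealD => //; apply: st_idealZ.
(* The eigenvector [a1 * w] is a unit multiple of [E_mu], as it would lie in [l I]
   otherwise. *)
have [s sE] := proj_ideal muU (st_ideal_mul a1 Iw).
rewrite (proj_eigen muU eig) in sE.
have us : s \is a GRing.unit.
  apply: (local_unit locR) => t sl; apply: nJ1.
  rewrite -[a1 * w]scale1r -(mulVr unit_U) -scalerA sE; apply: in_JZ.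
  exists 0, (t *: stE mu); split; first exact: in_I0.
    exact/st_idealZ/st_ideal_stE.
  by rewrite add0r galg_mulrn scalerA -sl.
pose a2 := (s^-1 * #|U|%:R) *: a1.
have a2w : a2 * w = stE mu.
  by rewrite galgMZl -scalerA sE scalerA mulVr // scale1r.
have nJmu : ~ in_J c (stE mu).
  move=> /(in_JZ (#|U|%:R^-1 * s)); rewrite -scalerA -sE scalerA.
  by rewrite mulVr ?unit_U // scale1r.
have [y [y' [Iy Iy' jE]]] := in_J_mul a2 Jj.
have muE : stE mu = (a2 * a * stE lam + y) + y' *+ l.
  by rewrite -a2w wE mulrDr jE mulrA addrA.
have muI : in_I c (stE mu).
  apply: stE_congr_in_I muE => //; apply: in_ID.
    exact/in_I_mul/stE_in_I_index.
  exact: in_IW Iy.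
have muc : logn l (pindex mu) = c.
  apply/eqP; rewrite eqn_leq (stE_in_I_dvd muU muI) andbT leqNgt.
  by apply/negP=> /(stE_in_J _ muU).
have conjI : in_I c (stE (conj_char mu)).
  by rewrite -alternating_stE //; apply: in_I_mul.
have nf : ~ form_in c.+1 (a2 * a * stE lam) (stE (conj_char mu)).
  move=> f1; have : (c.+1 <= logn l (pindex mu))%N.
    apply: form_conj_level => //; apply/form_inC; rewrite muE.
    apply: form_inDl; first apply: form_inDl => //.
      by apply: (Iy.2); apply: st_ideal_stE.
    have [r rE] := form_inC (conjI.2 _ Iy').
    by exists r; rewrite galg_mulrn dotZl rE exprS mulrCA !mulrA.
  by rewrite muc ltnn.
have [g ng] := form_in_suml_ex nf.
pose x := gelt g^-1%g * stE (conj_char mu).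
have nx : ~ form_in c.+1 x (stE lam).
  by move=> xf; apply: ng; rewrite /form_in dot_gelt dotC.
have Ix : st_ideal x by apply/st_ideal_mul/st_ideal_stE.
have clamU := conj_charP lamU.
have [r3 r3E] := proj_ideal clamU Ix.
have ur3 : r3 \is a GRing.unit.
  apply: (local_unit locR) => t r3l; apply: nx.
  apply: (form_in_unit unit_U); rewrite /form_in dotZl -dot_proj // r3E dotZl.
  have [r rE] : form_in c (stE (conj_char lam)) (stE lam).
    apply/form_inC; apply: stE_in_I_index.2; exact: st_ideal_stE.
  by exists (t * r); rewrite rE r3l exprS mulrCA mulrACA.
exists (gelt (alternating G) * (r3^-1 *: proj (conj_char lam)) *
  (gelt g^-1%g * (gelt (alternating G) * a2))).
have -> : gelt (alternating G) * (r3^-1 *: proj (conj_char lam)) *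
  (gelt g^-1%g * (gelt (alternating G) * a2)) * w =
  gelt (alternating G) * (r3^-1 *: (proj (conj_char lam) * x)).
  rewrite -!mulrA a2w alternating_stE // -/x galgMZl.
  by [].
by rewrite r3E scalerA mulVr // scale1r alternating_stE_conj.
Qed.

End MainCharacter.
End Filtration.

(** * The general linear group *)

Section Bridge.
Variables (n : nat) (F : finFieldType).

Lemma GL_surj (A : 'M[F]_n.-1.+1) : A \in unitmx ->
  exists g : {'GL_n[F]}, GLval g == A.
Proof. by move=> uA; exists (FinRing.Unit uA). Qed.

Definition GL_group : linear_group F n.-1 :=
  @LinearGroup F n.-1 {'GL_n[F]} (@GLval n F) val_inj (fun g h => erefl) GL_surj.
Local Notation G := GL_group.

Lemma GL_borelE : borel n F = lg_borel G.
Proof. by apply/setP=> g; rewrite !inE. Qed.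

Lemma GL_unitriE : unitri n F = lg_unitri G.
Proof. by apply/setP=> g; rewrite !inE. Qed.

Lemma GL_permE s : perm_GL F s = permGL G s.
Proof. by apply: (@mx_inj _ _ G); rewrite permGLE. Qed.

Variables (R : idomainType) (lam : {'GL_n[F]} -> R).

Lemma GL_epsE : eps n F R = st_eps G R.
Proof.
apply: eq_bigr => s _; rewrite GL_permE /bhat -GL_borelE.
by [].
Qed.

Lemma GL_characterP : unitri_character lam -> @linear_character F n.-1 G R lam.
Proof.
case=> ulam mlam; split=> [u|u v]; rewrite -GL_unitriE; first exact: ulam.
exact: mlam.
Qed.

Lemma GL_nontrivial_rootE (i j : 'I_n.-1.+1) : i != j ->
  nontrivial_on_root lam i j = @nontrivial_root F n.-1 G R lam i j.
Proof.
move=> nij.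
apply/existsP/existsP=> [[u /andP[/existsP[a /eqP ua] lam_u]]|[a lam_a]].
  exists a; rewrite (_ : rootGL G i j a = u) //.
  by apply: (@mx_inj _ _ G); rewrite rootGLE.
exists (rootGL G i j a); rewrite lam_a andbT; apply/existsP; exists a.
by apply/eqP; have := rootGLE G a nij.
Qed.

Lemma GL_parabolicE :
  parabolic lam = parabolic_of G (@nontrivial_root F n.-1 G R lam).
Proof.
apply: (congr1 (@generated G)); apply: (congr2 (@setU G)); first exact: GL_borelE.
apply: (@eq_finset G) => g; apply: eq_existsb => i; apply: eq_existsb => j.
have [ji|//] := eqVneq (j : nat) i.+1; rewrite /= GL_permE.
by rewrite GL_nontrivial_rootE // -val_eqE /= ji ltn_eqF.
Qed.

End Bridge.

Section QuotientModule.
Variables (n : nat) (F : finFieldType) (R : idomainType) (l p : nat) (z : R).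
Hypotheses (pr_l : prime l) (pF : p \in [pchar F]) (lp : l != p).
Hypotheses (R0 : [pchar R] =i pred0) (locR : local_with_maximal_ideal (l%:R : R)).
Hypothesis prim_z : p.-primitive_root z.
Variable K : residue_field (l%:R : R).
Local Notation G := (GL_group n F).
Local Notation A := (galg R {'GL_n[F]}).
Local Notation AK := (galg K {'GL_n[F]}).
Local Notation St := (steinberg n F R).
Implicit Types (x y : St) (a : A) (c d : nat).

Lemma steinberg_val_ideal x : @st_ideal F n.-1 G R (steinberg_val x).
Proof. by have /asboolP[a xE] := steinberg_valP x; exists a; rewrite -GL_epsE. Qed.

Lemma ideal_steinberg (w : A) : @st_ideal F n.-1 G R w ->
  exists x : St, steinberg_val x = w.
Proof.
case=> a; rewrite -GL_epsE => wE.
have wI : (w : (galg R {'GL_n[F]})^o) \in @steinberg_ideal n F R.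
  by apply/asboolP; exists a.
by exists (Steinberg wI).
Qed.

Lemma steinberg_val_inj x y : steinberg_val x = steinberg_val y -> x = y.
Proof. exact: val_inj. Qed.

Lemma steinberg_valD x y : steinberg_val (x + y) = steinberg_val x + steinberg_val y.
Proof. by []. Qed.

Lemma steinberg_valZ a x : steinberg_val (a *: x) = a * steinberg_val x.
Proof. by []. Qed.

Lemma steinberg_val_mulrn x m : steinberg_val (x *+ m) = steinberg_val x *+ m.
Proof. exact: (raddfMn (val : St -> (galg R {'GL_n[F]})^o)). Qed.

Lemma form_dotP c x y :
  (exists r, Defs.form (steinberg_val x) (steinberg_val y) = tofrac (l%:R ^+ c * r)) <->
  @form_in F n.-1 G R l c (steinberg_val x) (steinberg_val y).
Proof.
have B0 : (#|borel n F|%:R : R) != 0.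
  rewrite GL_borelE; apply: (natr_neq0 R0).
  exact: (cardG_gt0 (borel_group G)).
have B0' : (#|borel n F|%:R : {fraction R}) != 0.
  by rewrite -(rmorph_nat (@tofrac R)) tofrac_eq0.
rewrite /form_in -GL_borelE /Defs.form; split=> [[r rE]|[r rE]]; exists r.
  apply/eqP; rewrite -tofrac_eq; apply/eqP; rewrite tofracM -rE rmorph_nat mulrC divfK //.
by rewrite [X in tofrac X]rE tofracM rmorph_nat mulrC mulKf.
Qed.

Lemma Isub_in_I c x : x \in Isub l c <-> @in_I F n.-1 G R l c (steinberg_val x).
Proof.
split=> [/asboolP xc|[_ xc]].
  split=> [|w /ideal_steinberg[y <-]]; first exact: steinberg_val_ideal.
  exact/form_dotP/xc.
by apply/asboolP=> y; apply/form_dotP/xc/steinberg_val_ideal.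
Qed.

(** Membership in [L(c + 1)] upstairs, in the group algebra over [R]. *)
Lemma Lsub_in_J c x :
  red K x \in @Lsub n F R l K c.+1 <-> @in_J F n.-1 G R l c (steinberg_val x).
Proof.
split=> [/asboolP[y [y' [yc /redE[y'' xE]]]]|[w [w' [wI Iw' xE]]]].
  exists (steinberg_val y), (steinberg_val (y' + y'')); split.
  - exact/Isub_in_I.
  - exact: steinberg_val_ideal.
  rewrite -steinberg_val_mulrn -steinberg_valD; congr steinberg_val.
  by rewrite mulrnDl -xE addrA addrCA subrr addr0.
have [y yE] := ideal_steinberg wI.1; have [y' y'E] := ideal_steinberg Iw'.
apply/asboolP; exists y, y'; split; first by apply/Isub_in_I; rewrite yE.
congr (red K _); apply: steinberg_val_inj.
by rewrite steinberg_valD steinberg_val_mulrn yE y'E.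
Qed.

Variable lam : {'GL_n[F]} -> R.
Hypothesis lamU : unitri_character lam.
Let c := logn l #|'GL_n[F] : parabolic lam|%g.
Let lamU' : @linear_character F n.-1 G R lam := GL_characterP lamU.

Lemma index_pindex : c = logn l (@pindex F n.-1 G R lam).
Proof. by rewrite /c /pindex -GL_parabolicE. Qed.

Lemma steinberg_val_Elam : steinberg_val (Elam lam) = @stE F n.-1 G R lam.
Proof.
have steinberg_val_sum (I : finType) (Q : pred I) (f : I -> St) :
    steinberg_val (\sum_(i | Q i) f i) = \sum_(i | Q i) (steinberg_val (f i) : A).
  by apply: (big_morph (fun x => steinberg_val x : A)).
rewrite /Elam steinberg_val_sum /stE /proj mulr_suml -GL_unitriE.
by apply: eq_bigr => u _; rewrite steinberg_valZ /= GL_epsE.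
Qed.

Let gen : @Mquot n F R l K c := quot_lmod_pi (@Lsub n F R l K c.+1) (@Flam n F R l K lam).

Lemma scale_gen a : galg_proj K a *: gen =
  quot_lmod_pi (@Lsub n F R l K c.+1) (red K (a *: Elam lam)).
Proof.
rewrite /gen [LHS]quot_lmod_scale_pi; congr quot_lmod_pi.
exact: red_scale.
Qed.

Lemma quot_red_eq0 x : quot_lmod_pi (@Lsub n F R l K c.+1) (red K x) = 0 <->
  @in_J F n.-1 G R l c (steinberg_val x).
Proof.
rewrite -Lsub_in_J -[0](raddf0 (quot_lmod_pi (@Lsub n F R l K c.+1))).
by rewrite (quot_lmod_piE (@Lsub n F R l K c.+1)) subr0.
Qed.

Lemma gen_in_Lsub : @Flam n F R l K lam \in @Lsub n F R l K c.
Proof.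
apply/asboolP; exists (Elam lam), 0; rewrite mul0rn addr0; split=> //.
apply/Isub_in_I; rewrite steinberg_val_Elam index_pindex.
exact: (@stE_in_I_index F n.-1 G R l lam lamU').
Qed.

(** The idempotent of [lam] projects the module onto the line of its generator,
    and all coefficients are lifted to [R], where [stE_generated] applies. *)
Theorem Nlam_absolutely_irreducible : absolutely_irreducible (Nlam K lam c).
Proof.
pose e := galg_proj K ((#|lg_unitri G|%:R^-1 : R) *: (@proj F n.-1 G R lam : A)).
have uU := unit_U G pr_l pF lp locR.
apply: (@line_criterion _ _ (@Mquot n F R l K c) gen e).
- apply/eqP=> gen0; apply: (stE_notin_J pr_l pF lp R0 locR lamU').
  by rewrite -index_pindex -steinberg_val_Elam; apply/quot_red_eq0.
- rewrite /e scale_gen /gen; congr (quot_lmod_pi _ (red K _)).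
  apply: steinberg_val_inj; rewrite steinberg_valZ steinberg_val_Elam galgMZl.
  by rewrite (proj_stE lamU') scalerA mulVr // scale1r.
- move=> a; rewrite -[a]galg_liftK -galg_projM.
  set a' := galg_lift a.
  have [r rE] := @proj_ideal F n.-1 G R lam lamU' (a' * @stE F n.-1 G R lam)
    (@st_ideal_mul F n.-1 G R a' _ (@st_ideal_stE F n.-1 G R lam)).
  exists (rf_proj K (#|lg_unitri G|%:R^-1 * r)).
  have -> : rf_proj K (#|lg_unitri G|%:R^-1 * r) *: (1 : AK) =
      galg_proj K ((#|lg_unitri G|%:R^-1 * r) *: (1 : A)).
    apply: galgP => g; rewrite galgZ galg_projE galgZ rmorphM !geltE.
    by rewrite rmorph_nat.
  rewrite !scale_gen; congr (quot_lmod_pi _ (red K _)).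
  apply: steinberg_val_inj; rewrite !steinberg_valZ steinberg_val_Elam.
  by rewrite !galgMZl -mulrA [_ * _]rE scalerA mul1r.
- move=> a; rewrite -[a]galg_liftK; set a' := galg_lift a.
  rewrite scale_gen => /eqP nz.
  have [|||b bE] := @stE_generated F n.-1 G R l p z pr_l pF lp R0 locR prim_z
    lam lamU' a' (a' * @stE F n.-1 G R lam) 0.
  + by rewrite addr0.
  + exact: in_J0.
  + by rewrite -index_pindex -steinberg_val_Elam -steinberg_valZ => /quot_red_eq0.
  exists (galg_proj K b); rewrite -galg_projM scale_gen /gen.
  congr (quot_lmod_pi _ (red K _)); apply: steinberg_val_inj.
  by rewrite steinberg_valZ steinberg_val_Elam -mulrA.
by move=> w; split=> [/asboolP|[a ->]]; last by apply/asboolP; exists a.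
Qed.

Theorem Nlam_sub_Msub : {subset Nlam K lam c <= Msub K c}.
Proof.
move=> w /asboolP[a ->]; apply/asboolP; exists (a *: @Flam n F R l K lam).
  by apply: rpredZ; apply: gen_in_Lsub.
by rewrite [LHS]quot_lmod_scale_pi.
Qed.

End QuotientModule.
Theorem theorem3p2 (n : nat) (hn : (2 <= n)%N)
  (p : nat) (F : finFieldType) (hp : p \in [pchar F])
  (l : nat) (hl : prime l) (hlp : l != p)
  (R : idomainType) (hR0 : [pchar R] =i pred0)
  (hRpid : principal_ideal_ring R)
  (hRloc : local_with_maximal_ideal (l%:R : R))
  (hRroot : exists z : R, p.-primitive_root z)
  (K : residue_field (l%:R : R))
  (lam : {'GL_n[F]} -> R) (hlam : unitri_character lam) :
  let c := logn l #|'GL_n[F] : parabolic lam|%g in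
  {subset Nlam K lam c <= Msub K c} /\ absolutely_irreducible (Nlam K lam c).
Proof.
have [z prim_z] := hRroot; split; first exact: Nlam_sub_Msub.
exact: (Nlam_absolutely_irreducible hl hp hlp hR0 hRloc prim_z).
Qed.
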